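(* Let $\mathcal{B}(\Omega)$ be a Bergman-type space with Rudin–Forelli constant $\kappa$. Let $T$ be a linear operator defined a priori only on the linear span of the normalized reproducing kernels $\{k_z\}$ of $\mathcal{B}(\Omega)$, and assume there is a linear operator $T^*$ defined on the same span such that $\langle Tk_z,k_w\rangle=\langle k_z,T^*k_w\rangle$ for all $z,w\in\Omega$. If for some $p>\frac{4-\kappa}{2-\kappa}$ $$\sup_{z\in\Omega}\|U_zTk_z\|_{L^p(\Omega;d\sigma)}<\infty\quad\text{and}\quad\sup_{z\in\Omega}\|U_zT^*k_z\|_{L^p(\Omega;d\sigma)}<\infty,$$ then $T$ extends to a bounded operator on $\mathcal{B}(\Omega)$.
   Context: Notation: $A\lesssim B$ means $A\le CB$ for a constant $C$ independent of the relevant variables; $A\simeq B$ means $A\lesssim B$ and $B\lesssim A$. Bergman-type space: $\Omega\subset\mathbb{C}^n$ is a domain containing $0$ such that: (A.1) for each $z\in\Omega$ there is an involutive biholomorphic automorphism $\varphi_z$ of $\Omega$ with $\varphi_z(0)=z$; (A.2) there is a metric $d$ on $\Omega$ with $d(u,v)\simeq d(\varphi_z(u),\varphi_z(v))$ uniformly in $u,v,z$; $(\Omega,d)$ is separable and every closed $d$-ball is compact; $D(z,r)$ denotes the $d$-ball of center $z$ and radius $r$; (A.3) $\sigma$ is a finite Borel measure on $\Omega$, $\mathcal{B}(\Omega)$ is the space of holomorphic functions on $\Omega$ lying in $L^2(\Omega;d\sigma)$ with the $L^2(\sigma)$ norm $\|\cdot\|$ and inner product $\langle\cdot,\cdot\rangle$;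 $\mathcal{B}(\Omega)$ is a reproducing kernel Hilbert space with reproducing kernel $K_z$ ($f(z)=\langle f,K_z\rangle$) and normalized kernel $k_z=K_z/\|K_z\|$; $z\mapsto\|K_z\|$ is continuous on $(\Omega,d)$; (A.4) the measure $d\lambda(z):=\|K_z\|^2d\sigma(z)$ satisfies $\lambda(E)\simeq\lambda(\varphi_z(E))$ for Borel $E$, uniformly in $z$, and is doubling: $\lambda(D(z,2r))\le C\lambda(D(z,r))$ for all $z,r>0$; (A.5) $|\langle k_z,k_w\rangle|\simeq 1/\|K_{\varphi_z(w)}\|$ uniformly in $z,w$; (A.6) (Rudin–Forelli estimates) there is a constant $\kappa\in[0,2)$ such that, if $\kappa>0$, for all $r>\kappa>s>0$ one has $\sup_{z\in\Omega}\int_\Omega \frac{|\langle K_z,K_w\rangle|^{(r+s)/2}}{\|K_z\|^s\|K_w\|^r}d\lambda(w)<\infty$, and if $\kappa=0$ this holds for all $r=s>0$; (A.7) $\|K_z\|\to\infty$ as $d(z,0)\to\infty$. Translation operators: $U_zf(w):=f(\varphi_z(w))k_z(w)$ for $z\in\Omega$. *)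

(* Defs.v *)
(* MathComp + MathComp-Analysis (R : realType), complex numbers R[i]
   from mathcomp-real-closed.  C^n is modelled as row vectors 'rV[R[i]]_n. *)
From HB Require Import structures.
From mathcomp Require Import all_boot all_order all_algebra.
From mathcomp Require Import all_classical all_reals all_analysis.
From mathcomp Require Import complex.

Set Implicit Arguments.
Unset Strict Implicit.
Unset Printing Implicit Defensive.

Import Order.TTheory GRing.Theory Num.Theory.
Local Open Scope classical_set_scope.
Local Open Scope ring_scope.

(* The space C^n                                                        *)

Definition Cn (R : realType) (n : nat) : Type := 'rV[R[i]]_n.

HB.instance Definition _ (R : realType) (n : nat) :=
  Choice.copy (Cn R n) 'rV[R[i]]_n.
HB.instance Definition _ (R : realType) (n : nat) :=
  isPointed.Build (Cn R n) 0.

(* modulus of a complex number *)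
Definition cabs (R : realType) (z : R[i]) : R :=
  Num.sqrt (complex.Re z ^+ 2 + complex.Im z ^+ 2).

Section Defs.
Variables (R : realType) (n : nat).
Local Notation C := (R[i]).
Local Notation V := (Cn R n).

(* Euclidean norm on C^n *)
Definition vnorm (h : V) : R :=
  Num.sqrt (\sum_(j < n) (cabs (h ord0 j)) ^+ 2).

(* Euclidean open sets of C^n *)
Definition Copen (A : set V) : Prop :=
  forall x, A x -> exists2 e : R, 0 < e & forall y, vnorm (y - x) < e -> A y.

(* A domain: a nonempty connected open set *)
Definition Cconnected (A : set V) : Prop :=
  forall U W : set V, Copen U -> Copen W -> U `&` W `&` A = set0 ->
    A `<=` U `|` W -> A `&` U = set0 \/ A `&` W = set0.

Definition Cdomain (A : set V) : Prop :=
  Copen A /\ A !=set0 /\ Cconnected A.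

(* Holomorphy (complex Frechet differentiability at every point of Om)
   of a scalar function, and of a C^n-valued map (coordinatewise). *)
Definition holo_on (Om : set V) (f : V -> C) : Prop :=
  forall z, Om z -> exists a : 'rV[C]_n, forall e : R, 0 < e ->
    exists2 delta : R, 0 < delta & forall h : V, vnorm h < delta ->
      cabs (f (z + h) - f z - \sum_(j < n) a ord0 j * h ord0 j)
        <= e * vnorm h.

Definition holo_map_on (Om : set V) (F : V -> V) : Prop :=
  forall j : 'I_n, holo_on Om (fun w => F w ord0 j).

(* The Borel sigma-algebra of C^n *)
Definition CBorel := g_sigma_algebraType (Copen : set (set V)).

(* L^2 quantities with respect to a measure sigma on C^n                *)
Variable sigma : {measure set CBorel -> \bar R}.

(* complex-valued integral over a set D *)
Definition cintegral (D : set V) (h : V -> C) : C :=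
  Complex (Rintegral sigma D (fun x => complex.Re (h x))) (Rintegral sigma D (fun x => complex.Im (h x))).

(* L^2 inner product and norm over Om *)
Definition inner (Om : set V) (f g : V -> C) : C :=
  cintegral Om (fun x => f x * (g x)^*).

Definition L2norm (Om : set V) (f : V -> C) : R :=
  Num.sqrt (fine (\int[sigma]_(x in Om) ((cabs (f x)) ^+ 2)%:E)%E).

(* The space B(Om): holomorphic functions on Om lying in L^2(Om; sigma).
   Functions are extended by 0 outside Om, so that equality of elements
   of B(Om) is plain equality of functions. *)
Definition Bspace (Om : set V) (f : V -> C) : Prop :=
  holo_on Om f /\ (forall w, ~ Om w -> f w = 0) /\
  (\int[sigma]_(x in Om) ((cabs (f x)) ^+ 2)%:E < +oo)%E.

(* K : z |-> K_z is the reproducing kernel of B(Om) *)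
Definition reproducing_kernel (Om : set V) (K : V -> V -> C) : Prop :=
  (forall z, Om z -> Bspace Om (K z)) /\
  (forall f, Bspace Om f -> forall z, Om z -> f z = inner Om f (K z)).

(* B(Om) is complete for the L^2 norm (Hilbert space) *)
Definition Bcomplete (Om : set V) : Prop :=
  forall u : nat -> V -> C, (forall k, Bspace Om (u k)) ->
    (forall e : R, 0 < e -> exists N, forall k l, (N <= k)%N -> (N <= l)%N ->
        L2norm Om (u k \- u l) < e) ->
    exists2 f, Bspace Om f &
      forall e : R, 0 < e -> exists N, forall k, (N <= k)%N ->
        L2norm Om (u k \- f) < e.

Definition Knorm (Om : set V) (K : V -> V -> C) (z : V) : R := L2norm Om (K z).

(* normalized kernel k_z *)
Definition nkernel (Om : set V) (K : V -> V -> C) (z : V) : V -> C :=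
  fun w => K z w / Complex (Knorm Om K z) 0.

(* the measure d lambda = ||K_z||^2 d sigma *)
Definition lambda (Om : set V) (K : V -> V -> C) (E : set V) : \bar R :=
  (\int[sigma]_(x in E) ((Knorm Om K x) ^+ 2)%:E)%E.

(* the linear span of the normalized kernels {k_z : z in Om} *)
Definition kspan (Om : set V) (K : V -> V -> C) (f : V -> C) : Prop :=
  exists s : seq (C * V), (forall x, x \in s -> Om x.2) /\
    f = (fun w => \sum_(x <- s) x.1 * nkernel Om K x.2 w).

(* translation operators U_z f (w) = f(phi_z(w)) k_z(w) *)
Definition transl (Om : set V) (K : V -> V -> C) (phi : V -> V -> V)
  (z : V) (f : V -> C) : V -> C :=
  fun w => f (phi z w) * nkernel Om K z w.

End Defs.

(* Metric notions for (Om, d)                                           *)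
Section Metric.
Variables (R : realType) (T : Type).
Variables (Om : set T) (d : T -> T -> R).

Definition is_metric_on : Prop :=
  (forall x y, Om x -> Om y -> 0 <= d x y) /\
  (forall x y, Om x -> Om y -> d x y = 0 <-> x = y) /\
  (forall x y, Om x -> Om y -> d x y = d y x) /\
  (forall x y z, Om x -> Om y -> Om z -> d x z <= d x y + d y z).

(* open d-ball D(z,r) and closed d-ball *)
Definition dball (z : T) (r : R) : set T := [set w | Om w /\ d z w < r].
Definition cdball (z : T) (r : R) : set T := [set w | Om w /\ d z w <= r].

Definition dopen (U : set T) : Prop :=
  U `<=` Om /\ forall x, U x -> exists2 e : R, 0 < e & dball x e `<=` U.

Definition dcompact (A : set T) : Prop :=
  A `<=` Om /\
  forall F : set (set T), (forall U, F U -> dopen U) ->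
    (forall x, A x -> exists2 U, F U & U x) ->
    exists s : seq (set T), (forall U, U \in s -> F U) /\
      (forall x, A x -> exists2 U, U \in s & U x).

Definition dseparable : Prop :=
  exists D : nat -> T, (forall k, Om (D k)) /\
    forall x, Om x -> forall e : R, 0 < e -> exists k, d x (D k) < e.

End Metric.

(* Bergman-type spaces: conditions (A.1)-(A.7)                          *)
Section Bergman.
Variables (R : realType) (n : nat).
Local Notation V := (Cn R n).
Local Notation C := (R[i]).
Local Open Scope ereal_scope.

Definition bergman_type (Om : set V) (phi : V -> V -> V) (d : V -> V -> R)
  (sigma : {measure set CBorel R n -> \bar R}) (K : V -> V -> C) (kappa : R) : Prop :=
  let KN := Knorm sigma Om K in
  let k := nkernel sigma Om K in
  let lam := lambda sigma Om K in
  (* Om is a domain containing 0 *)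
  Cdomain Om /\ Om 0%R /\
  (* (A.1) involutive biholomorphic automorphisms phi_z with phi_z(0) = z *)
  (forall z, Om z ->
     (forall w, Om w -> Om (phi z w)) /\
     (forall w, Om w -> phi z (phi z w) = w) /\
     holo_map_on Om (phi z) /\
     phi z 0%R = z) /\
  (* (A.2) the metric d *)
  is_metric_on Om d /\
  (exists c : R, forall z u v, Om z -> Om u -> Om v ->
     (d u v <= c * d (phi z u) (phi z v))%R /\
     (d (phi z u) (phi z v) <= c * d u v)%R) /\
  dseparable Om d /\
  (forall z (r : R), Om z -> dcompact Om d (cdball Om d z r)) /\
  (* (A.3) sigma finite Borel measure on Om; B(Om) is a RKHS with kernel K *)
  sigma (~` Om) = 0 /\ sigma setT < +oo /\
  reproducing_kernel sigma Om K /\ Bcomplete sigma Om /\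
  (forall z, Om z -> forall e : R, (0 < e)%R -> exists2 delta : R, (0 < delta)%R &
     forall w, Om w -> (d z w < delta)%R -> (`|KN w - KN z| < e)%R) /\
  (* (A.4) lambda is quasi-invariant under phi_z and doubling *)
  (exists c : R, forall z (E : set V), Om z -> measurable (E : set (CBorel R n)) ->
     E `<=` Om ->
     lam E <= c%:E * lam (phi z @` E) /\ lam (phi z @` E) <= c%:E * lam E) /\
  (exists c : R, forall z (r : R), Om z -> (0 < r)%R ->
     lam (dball Om d z (2 * r)) <= c%:E * lam (dball Om d z r)) /\
  (* (A.5) *)
  (exists c : R, forall z w, Om z -> Om w ->
     (cabs (inner sigma Om (k z) (k w)) <= c / KN (phi z w))%R /\
     ((KN (phi z w))^-1 <= c * cabs (inner sigma Om (k z) (k w)))%R) /\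
  (* (A.6) Rudin--Forelli estimates with constant kappa in [0,2) *)
  (0 <= kappa)%R /\ (kappa < 2)%R /\
  (let RF (r s : R) := exists M : R, forall z, Om z ->
      \int[sigma]_(w in Om)
        ((cabs (inner sigma Om (K z) (K w)) `^ ((r + s) / 2)
           / (KN z `^ s * KN w `^ r)) * KN w ^+ 2)%:E <= M%:E in
   ((0 < kappa)%R -> forall r s : R, (kappa < r)%R -> (0 < s)%R -> (s < kappa)%R -> RF r s) /\
   (kappa = 0%R -> forall r : R, (0 < r)%R -> RF r r)) /\
  (* (A.7) ||K_z|| -> oo as d(z,0) -> oo *)
  (forall M : R, exists N : R, forall z, Om z -> (N < d z 0%R)%R -> (M < KN z)%R).

End Bergman.

(* Main.v *)
(* The extension is S f (z) = <f, T* K_z>, an integral operator whose kernel has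
   modulus |T* K_z (w)| = |T K_w (z)| and is bounded by Schur's test with the
   weight ||K_w||^a, a = 1 - beta/q, where 1/p + 1/q = 1. For the row estimates,
   the change of variables w -> phi_z(w) and (A.5) turn the bound on U_z T* k_z
   in L^p(sigma) into a bound on T* k_z in L^p(lambda) with the weight
   ||K_w||^(-p) |<k_z, k_w>|^(2 - p). Hoelder's inequality then leaves the
   integral of |<k_z, k_w>|^(2 - q) ||K_w||^(-beta) against lambda, which is the
   Rudin-Forelli estimate with exponents 2 - q + beta and 2 - q - beta. Such a
   beta exists because p > (4 - kappa)/(2 - kappa) iff 2 - q > kappa/2. Finally
   S f lies in the Bergman space because it is the Riesz representative of
   g |-> <f, T* g> on the span of the kernels, where T* is bounded by the same
   Schur test. *)
Require Import Defs.
From HB Require Import structures.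
From mathcomp Require Import all_boot all_order all_algebra.
From mathcomp Require Import all_classical all_reals all_analysis.
From mathcomp Require Import measurable_realfun complex.
From mathcomp Require Import ring lra.

Set Implicit Arguments.
Unset Strict Implicit.
Unset Printing Implicit Defensive.

Import Order.TTheory GRing.Theory Num.Theory.
Import numFieldNormedType.Exports.
Local Open Scope classical_set_scope.
Local Open Scope ring_scope.

Section Density.
Import HBNNSimple.
Local Open Scope ereal_scope.
Context d (T : measurableType d) (R : realType).
Variables (mu : {measure set T -> \bar R}) (W : T -> R).
Hypothesis mW : measurable_fun [set: T] W.
Hypothesis W0 : forall x, (0 <= W x)%R.

Definition density of measurable_fun [set: T] W & (forall x, (0 <= W x)%R) :=
  fun A => \int[mu]_(x in A) (W x)%:E.

Local Notation nu := (density mW W0).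

Let density0 : nu set0 = 0. Proof. exact: integral_set0. Qed.

Let density_ge0 A : 0 <= nu A.
Proof. by apply: integral_ge0 => x _; rewrite lee_fin. Qed.

Let density_sigma_additive : semi_sigma_additive nu.
Proof.
apply: semi_sigma_additive_nng_induced; first exact/measurable_EFinP.
by move=> x; rewrite lee_fin.
Qed.

HB.instance Definition _ := isMeasure.Build _ _ _ nu density0 density_ge0
  density_sigma_additive.

Let integral_density_nnsfun (D : set T) (h : {nnsfun T >-> R}) : measurable D ->
  \int[nu]_(x in D) (h x)%:E = \int[mu]_(x in D) ((h x)%:E * (W x)%:E).
Proof.
move=> mD; have mA r : measurable (h @^-1` [set r]) by exact: measurable_sfunP.
have mWD : measurable_fun D (EFin \o W).
  exact/measurable_EFinP/measurable_funTS.
have mind r : measurable_fun D (fun x => (r * \1_(h @^-1` [set r]) x)%:E).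
  by apply/measurable_EFinP; exact: measurable_funM.
transitivity (\sum_(r \in range h)
    \int[nu]_(x in D) (r * \1_(h @^-1` [set r]) x)%:E).
  under eq_integral do rewrite fimfunE -fsumEFin//.
  by rewrite ge0_integral_fsum// => r x _; exact: nnfun_muleindic_ge0.
transitivity (\sum_(r \in range h)
    \int[mu]_(x in D) ((r * \1_(h @^-1` [set r]) x)%:E * (W x)%:E)); last first.
  rewrite -ge0_integral_fsum//.
  - apply: eq_integral => x _; rewrite [in RHS]fimfunE -fsumEFin//.
    by rewrite ge0_mule_fsuml// => r; exact: nnfun_muleindic_ge0.
  - by move=> r; exact: emeasurable_funM.
  - by move=> r x _; apply: mule_ge0; rewrite ?nnfun_muleindic_ge0// lee_fin.
apply: eq_fsbigr => r /set_mem [x0 _ <-].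
under [LHS]eq_integral do rewrite EFinM.
rewrite ge0_integralZl_EFin//; last exact/measurable_EFinP/measurable_indic.
under [RHS]eq_integral do rewrite EFinM -muleA.
rewrite ge0_integralZl_EFin//; last 2 first.
- by move=> x _; rewrite mule_ge0 ?lee_fin.
- by apply: emeasurable_funM => //; exact/measurable_EFinP/measurable_indic.
rewrite integral_indic// /density; congr (_ * _).
rewrite [LHS]integral_mkcond [RHS]integral_mkcond; apply: eq_integral => x _.
rewrite !patchE in_setI indicE.
by case: (x \in D); case: (x \in _); rewrite ?mul1e ?mul0e.
Qed.

Lemma integral_density (D : set T) (g : T -> \bar R) : measurable D ->
  measurable_fun D g -> (forall x, D x -> 0 <= g x) ->
  \int[nu]_(x in D) g x = \int[mu]_(x in D) (g x * (W x)%:E).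
Proof.
move=> mD mg g0; pose h := nnsfun_approx mD mg.
have ndh x : {homo h ^~ x : m k / (m <= k)%N >-> (m <= k)%R}.
  by move=> m k mk; exact/lefP/nd_nnsfun_approx.
have mh k : measurable_fun D (EFin \o h k).
  exact/measurable_EFinP/measurable_funTS.
have hg x : D x -> (h k x)%:E @[k --> \oo] --> g x.
  by move=> Dx; exact: (cvg_nnsfun_approx mD mg g0 Dx).
transitivity (limn (fun k => \int[nu]_(x in D) (h k x)%:E)).
  rewrite -monotone_convergence//.
  - by apply: eq_integral => x /set_mem Dx; apply/esym/cvg_lim => //; exact: hg.
  - by move=> k x _; rewrite lee_fin.
  - by move=> x _ m k mk; rewrite lee_fin ndh.
under eq_fun do rewrite integral_density_nnsfun//.
rewrite -monotone_convergence//.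
- apply: eq_integral => x /set_mem Dx; apply/cvg_lim => //.
  by apply: cvgeZr => //; exact: hg.
- by move=> k; apply: emeasurable_funM; exact/measurable_EFinP/measurable_funTS.
- by move=> k x _; rewrite mule_ge0 ?lee_fin.
- by move=> x _ m k mk; rewrite lee_wpmul2r ?lee_fin ?ndh.
Qed.

End Density.

Section InvolutiveSubstitution.
Local Open Scope ereal_scope.
Context d (T : measurableType d) (R : realType).
Variables (nu : {measure set T -> \bar R}) (D : set T) (psi : T -> T) (c : R).
Hypothesis mD : measurable D.
Hypothesis mpsi : measurable_fun D psi.
Hypothesis psiD : forall x, D x -> D (psi x).
Hypothesis psiK : forall x, D x -> psi (psi x) = x.

Lemma image_involution (A : set T) : psi @` (D `&` A) = D `&` psi @^-1` A.
Proof.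
apply/seteqP; split=> [_ [x [Dx Ax] <-]|x [Dx Ax]].
  by split; [exact: psiD|rewrite /= psiK].
by exists (psi x); [split; [exact: psiD|]|exact: psiK].
Qed.

Hypothesis c0 : (0 <= c)%R.
Hypothesis quasi_invariant : forall E, measurable E -> E `<=` D ->
  nu E <= c%:E * nu (psi @` E).

(* On [D], [nu] is dominated by [c] times its pushforward under [psi]. *)
Lemma ge0_le_integral_involution (H : T -> \bar R) : measurable_fun D H ->
  (forall x, D x -> 0 <= H x) ->
  \int[nu]_(x in D) H x <= c%:E * \int[nu]_(x in D) H (psi x).
Proof.
move=> mH H0; pose g := patch id D psi; pose HD := H \_ D.
have gE x : D x -> g x = psi x by move=> Dx; rewrite /g /patch mem_set.
have mg : measurable_fun [set: T] g.
  rewrite -(setUv D); apply/(measurable_funU _ mD (measurableC mD)); split.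
    by apply: eq_measurable_fun mpsi => x /set_mem Dx; rewrite gE.
  apply: eq_measurable_fun (@measurable_id _ _ _) => x.
  by rewrite in_setC /g /patch => /negbTE ->.
have mHD : measurable_fun [set: T] HD by exact/(measurable_restrictT _ mD).
have HD0 x : 0 <= HD x by rewrite /HD patchE; case: ifPn => // /set_mem/H0.
have restrE (F : T -> \bar R) :
    \int[mrestr nu mD]_(x in D) F x = \int[nu]_(x in D) F x.
  by apply: eq_measure_integral => A mA AD; rewrite /= /mrestr setIidl.
have restr_le S : measurable S -> mrestr nu mD S <=
    mscale (NngNum c0) (pushforward (mrestr nu mD) g) S.
  move=> mS; rewrite /mscale /pushforward /mrestr /=.
  apply: (le_trans (quasi_invariant (measurableI _ _ mS mD) (@subIsetr _ _ _))).
  rewrite setIC image_involution le_eqVlt; apply/orP; left; apply/eqP.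
  congr (_ * nu _); apply/seteqP; split=> x [].
    by move=> Dx Sx; split => //=; rewrite gE.
  by move=> /= Sx Dx; split => //=; rewrite -gE.
have -> : \int[nu]_(x in D) H x = \int[mrestr nu mD]_(x in D) HD x.
  by rewrite restrE; apply: eq_integral => x; rewrite /HD patchE => ->.
apply: (@le_trans _ _
  (\int[mscale (NngNum c0) (pushforward (mrestr nu mD) g)]_(x in D) HD x)).
  exact: (ge0_le_measure_integral (restr_le mg)).
rewrite ge0_integral_mscale//; last exact: measurable_funTS.
apply: lee_wpmul2l; first by rewrite lee_fin.
rewrite ge0_integral_pushforward//; last exact: measurable_funTS.
have -> : g @^-1` D = D.
  apply/seteqP; split=> x /=; last by move=> Dx; rewrite gE//; exact: psiD.
  by rewrite /g /patch; case: ifPn => // /set_mem.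
rewrite restrE le_eqVlt; apply/orP; left; apply/eqP; apply: eq_integral => x xD.
by have Dx := set_mem xD; rewrite /= gE// /HD patchE mem_set//; exact: psiD.
Qed.

End InvolutiveSubstitution.

Lemma measurable_funV_gt0 d (T : measurableType d) (R : realType) (D : set T)
    (f : T -> R) : (forall x, D x -> 0 < f x) ->
  measurable_fun D f -> measurable_fun D (fun x => (f x)^-1).
Proof.
move=> f0 mf; apply: (@eq_measurable_fun _ _ _ _ _ (fun x => f x `^ (-1))).
  by move=> x /set_mem Dx; rewrite powR_inv1// ltW// f0.
exact: (measurableT_comp (measurable_powR (-1)) mf).
Qed.

Lemma measurable_fun_sqrt d (T : measurableType d) (R : realType) (D : set T)
    (f : T -> R) :
  measurable_fun D f -> measurable_fun D (fun x => Num.sqrt (f x)).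
Proof.
exact: (measurableT_comp (continuous_measurable_fun (@sqrt_continuous R))).
Qed.

Section TonelliOn.
Local Open Scope ereal_scope.
Context d1 d2 (X : measurableType d1) (Y : measurableType d2) (R : realType).
Variables (mu : {sigma_finite_measure set X -> \bar R}).
Variables (nu : {sigma_finite_measure set Y -> \bar R}).
Variables (A : set X) (B : set Y) (f : X -> Y -> \bar R).
Hypotheses (mA : measurable A) (mB : measurable B).
Hypothesis mf : measurable_fun (A `*` B) (fun u => f u.1 u.2).
Hypothesis f0 : forall x y, A x -> B y -> 0 <= f x y.

Let fAB : X * Y -> \bar R := (fun u => f u.1 u.2) \_ (A `*` B).

Let mfAB : measurable_fun [set: X * Y] fAB.
Proof. exact/(measurable_restrictT _ (measurableX mA mB)). Qed.

Let fAB_ge0 u : 0 <= fAB u.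
Proof. by rewrite /fAB patchE; case: ifPn => // /set_mem[]; exact: f0. Qed.

Let integral_fAB1 :
  (fun x => \int[nu]_(y in B) f x y) \_ A = fun x => \int[nu]_y fAB (x, y).
Proof.
apply/funext => x; rewrite patchE; case: ifPn => [Ax|/negbTE nAx].
  rewrite integral_mkcond; apply: eq_integral => y _.
  by rewrite /fAB !patchE in_setX Ax.
by rewrite integral0_eq// => y _; rewrite /fAB patchE in_setX nAx.
Qed.

Let integral_fAB2 :
  (fun y => \int[mu]_(x in A) f x y) \_ B = fun y => \int[mu]_x fAB (x, y).
Proof.
apply/funext => y; rewrite patchE; case: ifPn => [By|/negbTE nBy].
  rewrite integral_mkcond; apply: eq_integral => x _.
  by rewrite /fAB !patchE in_setX By andbT.
by rewrite integral0_eq// => x _; rewrite /fAB patchE in_setX nBy andbF.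
Qed.

Lemma measurable_integral_onr :
  measurable_fun A (fun x => \int[nu]_(y in B) f x y).
Proof.
apply/(measurable_restrictT _ mA); rewrite integral_fAB1.
exact: measurable_fun_fubini_tonelli_F.
Qed.

Lemma measurable_integral_onl :
  measurable_fun B (fun y => \int[mu]_(x in A) f x y).
Proof.
apply/(measurable_restrictT _ mB); rewrite integral_fAB2.
exact: measurable_fun_fubini_tonelli_G.
Qed.

Lemma fubini_tonelli_on :
  \int[mu]_(x in A) \int[nu]_(y in B) f x y =
  \int[nu]_(y in B) \int[mu]_(x in A) f x y.
Proof.
rewrite [LHS]integral_mkcond [RHS]integral_mkcond integral_fAB1 integral_fAB2.
exact: fubini_tonelli.
Qed.

End TonelliOn.

Section HoelderOn.
Local Open Scope ereal_scope.
Context d (T : measurableType d) (R : realType).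
Variables (mu : {measure set T -> \bar R}) (D : set T) (f g : T -> R).
Hypotheses (mD : measurable D) (mf : measurable_fun D f)
  (mg : measurable_fun D g).
Hypothesis f0 : forall x, D x -> (0 <= f x)%R.
Hypothesis g0 : forall x, D x -> (0 <= g x)%R.

Let Lnorm_restrict (h : T -> R) (p : R) :
  (0 < p)%R -> (forall x, D x -> (0 <= h x)%R) ->
  Lnorm mu p%:E (EFin \o (h \_ D)) = (\int[mu]_(x in D) (h x `^ p)%:E) `^ p^-1.
Proof.
move=> p0 h0; rewrite unlock [in RHS]integral_mkcond; congr (_ `^ _).
apply: eq_integral => x _; rewrite /= !patchE; case: ifPn => [/set_mem/h0 hx|_].
  by rewrite ger0_norm.
by rewrite normr0 powR0 ?gt_eqF.
Qed.

Lemma hoelder_on (p q : R) : (0 < p)%R -> (0 < q)%R -> (p^-1 + q^-1 = 1)%R ->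
  \int[mu]_(x in D) (f x * g x)%:E <=
  (\int[mu]_(x in D) (f x `^ p)%:E) `^ p^-1 *
  (\int[mu]_(x in D) (g x `^ q)%:E) `^ q^-1.
Proof.
move=> p0 q0 pq; rewrite -!Lnorm_restrict//.
apply: le_trans (hoelder mu _ _ p0 q0 pq); last 2 first.
- exact/(measurable_restrictT _ mD).
- exact/(measurable_restrictT _ mD).
rewrite Lnorm1 integral_mkcond le_eqVlt; apply/orP; left; apply/eqP.
apply: eq_integral => x _; rewrite /= !patchE; case: ifPn => [/set_mem Dx|_].
  by rewrite ger0_norm// mulr_ge0 ?f0 ?g0.
by rewrite mulr0 normr0.
Qed.

Lemma integral_cauchy_schwarz_on :
  (\int[mu]_(x in D) (f x * g x)%:E) ^+ 2 <=
  \int[mu]_(x in D) (f x ^+ 2)%:E * \int[mu]_(x in D) (g x ^+ 2)%:E.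
Proof.
have sqr0 (h : T -> R) : 0 <= \int[mu]_(x in D) (h x ^+ 2)%:E.
  by apply: integral_ge0 => x _; rewrite lee_fin sqr_ge0.
have powR2E (h : T -> R) : (forall x, D x -> (0 <= h x)%R) ->
    \int[mu]_(x in D) (h x `^ 2)%:E = \int[mu]_(x in D) (h x ^+ 2)%:E.
  by move=> h0; apply: eq_integral => x /set_mem Dx; rewrite powR_mulrn ?h0.
have fg0 : 0 <= \int[mu]_(x in D) (f x * g x)%:E.
  by apply: integral_ge0 => x Dx; rewrite lee_fin mulr_ge0 ?f0 ?g0.
rewrite -lee_sqrt ?mule_ge0// sqrte_sqr gee0_abs// sqrteM// -!poweR12_sqrt//.
rewrite -!powR2E//; apply: hoelder_on => //.
by rewrite [RHS]splitr !div1r.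
Qed.

End HoelderOn.

Section SchurTest.
Local Open Scope ereal_scope.
Context d1 d2 (X : measurableType d1) (Y : measurableType d2) (R : realType).
Variables (mu : {sigma_finite_measure set X -> \bar R}).
Variables (nu : {sigma_finite_measure set Y -> \bar R}).
Variables (A : set X) (B : set Y) (N : X -> Y -> R) (h : X -> R) (k : Y -> R).
Variables (a b : R).
Hypotheses (mA : measurable A) (mB : measurable B).
Hypothesis mN : measurable_fun (A `*` B) (fun u => N u.1 u.2).
Hypothesis N0 : forall x y, A x -> B y -> (0 <= N x y)%R.
Hypotheses (mh : measurable_fun A h) (mk : measurable_fun B k).
Hypotheses (h0 : forall x, A x -> (0 < h x)%R)
  (k0 : forall y, B y -> (0 < k y)%R).
Hypotheses (a0 : (0 <= a)%R) (b0 : (0 <= b)%R).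
Hypothesis row_bound :
  forall x, A x -> \int[nu]_(y in B) (N x y * k y)%:E <= (a * h x)%:E.
Hypothesis column_bound :
  forall y, B y -> \int[mu]_(x in A) (N x y * h x)%:E <= (b * k y)%:E.
Variables (f : Y -> R) (g : X -> R).
Hypotheses (mf : measurable_fun B f) (mg : measurable_fun A g).
Hypothesis f0 : forall y, B y -> (0 <= f y)%R.
Hypothesis g0 : forall x, A x -> (0 <= g x)%R.
Hypothesis g_le : forall x, A x ->
  (g x)%:E <= \int[nu]_(y in B) (N x y * f y)%:E.

Let q y := (f y ^+ 2 / k y)%R.

Let q0 y : B y -> (0 <= q y)%R.
Proof. by move=> By; rewrite divr_ge0 ?sqr_ge0 ?ltW ?k0. Qed.

Let mq : measurable_fun B q.
Proof.
by apply: measurable_funM; [exact: measurable_funX|exact: measurable_funV_gt0].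
Qed.

Let mNx x : A x -> measurable_fun B (N x).
Proof.
move=> Ax; apply: (@measurable_comp _ _ _ _ _ _ (A `*` B) (fun u => N u.1 u.2) _
  (pair x)) => //.
- exact: measurableX.
- by move=> _ [y By <-].
- by apply: measurable_funTS; exact: pair1_measurable.
Qed.

Let mNy y : B y -> measurable_fun A (N ^~ y).
Proof.
move=> By; apply: (@measurable_comp _ _ _ _ _ _ (A `*` B) (fun u => N u.1 u.2) _
  (pair^~ y)) => //.
- exact: measurableX.
- by move=> _ [x Ax <-].
- by apply: measurable_funTS; exact: pair2_measurable.
Qed.

(* Cauchy-Schwarz for [N f = sqrt (N k) * sqrt (N f^2 / k)]. *)
Let sqr_g_le x : A x ->
  (g x ^+ 2)%:E <= (a * h x)%:E * \int[nu]_(y in B) (N x y * q y)%:E.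
Proof.
move=> Ax; have Nk0 y : B y -> (0 <= N x y * k y)%R.
  by move=> By; rewrite mulr_ge0 ?N0// ltW ?k0.
have Nq0 y : B y -> (0 <= N x y * q y)%R by move=> By; rewrite mulr_ge0 ?N0 ?q0.
have mroot (u : Y -> R) : measurable_fun B u ->
    measurable_fun B (fun y => Num.sqrt (N x y * u y)).
  move=> mBu; apply: measurable_fun_sqrt.
  by apply: measurable_funM => //; exact: mNx.
have root_mulE y : B y ->
    (Num.sqrt (N x y * k y) * Num.sqrt (N x y * q y) = N x y * f y)%R.
  move=> By; rewrite -sqrtrM ?Nk0// -[RHS]ger0_norm ?mulr_ge0 ?N0 ?f0//
    -sqrtr_sqr.
  by congr Num.sqrt; rewrite /q; field; rewrite gt_eqF ?k0.
have := @integral_cauchy_schwarz_on _ Y R nu B _ _ mB (mroot k mk) (mroot q mq)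
  (fun _ _ => sqrtr_ge0 _) (fun _ _ => sqrtr_ge0 _).
rewrite (eq_integral (fun y => (N x y * f y)%:E)); last first.
  by move=> y /set_mem By; rewrite root_mulE.
rewrite [X in _ <= X * _](eq_integral (fun y => (N x y * k y)%:E)); last first.
  by move=> y /set_mem By; rewrite sqr_sqrtr ?Nk0.
rewrite [X in _ <= _ * X](eq_integral (fun y => (N x y * q y)%:E)); last first.
  by move=> y /set_mem By; rewrite sqr_sqrtr ?Nq0.
move=> cs; apply: (@le_trans _ _ ((\int[nu]_(y in B) (N x y * f y)%:E) ^+ 2)).
  rewrite EFin_expe lee_sqr ?g_le ?lee_fin ?g0//.
  by apply: integral_ge0 => y By; rewrite lee_fin mulr_ge0 ?N0 ?f0.
apply: (le_trans cs); apply: lee_wpmul2r; last exact: row_bound.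
by apply: integral_ge0 => y By; rewrite lee_fin Nq0.
Qed.

Let F x y := (h x * (N x y * q y))%:E.

Let F0 x y : A x -> B y -> 0 <= F x y.
Proof.
move=> Ax By; rewrite lee_fin.
exact: mulr_ge0 (ltW (h0 Ax)) (mulr_ge0 (N0 Ax By) (q0 By)).
Qed.

Let mF : measurable_fun (A `*` B) (fun u => F u.1 u.2).
Proof.
apply/measurable_EFinP/measurable_funM; last apply: measurable_funM => //.
  apply: (measurable_comp mA _ mh (measurable_funTS measurable_fst)).
  by move=> _ [u [Au _] <-].
apply: (measurable_comp mB _ mq (measurable_funTS measurable_snd)).
by move=> _ [u [_ Bu] <-].
Qed.

Let integral_row x : A x ->
  \int[nu]_(y in B) F x y = (h x)%:E * \int[nu]_(y in B) (N x y * q y)%:E.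
Proof.
move=> Ax; rewrite -ge0_integralZl_EFin ?ltW ?h0//.
- by move=> y By; rewrite lee_fin mulr_ge0 ?N0 ?q0.
- by apply/measurable_EFinP/measurable_funM => //; exact: mNx.
Qed.

Let integral_column y : B y ->
  \int[mu]_(x in A) F x y = (q y)%:E * \int[mu]_(x in A) (N x y * h x)%:E.
Proof.
move=> By; rewrite -ge0_integralZl_EFin ?q0//.
- by apply: eq_integral => x _; rewrite -EFinM /F; congr EFin; ring.
- by move=> x Ax; rewrite lee_fin mulr_ge0 ?N0// ltW ?h0.
- by apply/measurable_EFinP/measurable_funM => //; exact: mNy.
Qed.

Lemma schur_test :
  \int[mu]_(x in A) (g x ^+ 2)%:E <=
    (a * b)%:E * \int[nu]_(y in B) (f y ^+ 2)%:E.
Proof.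
apply: (@le_trans _ _ (\int[mu]_(x in A) (a%:E * \int[nu]_(y in B) F x y))).
  apply: ge0_le_integral => //.
  - by move=> x _; rewrite lee_fin sqr_ge0.
  - by apply/measurable_EFinP; exact: measurable_funX.
  - by apply: measurable_funeM; exact: measurable_integral_onr.
  - by move=> x Ax; rewrite integral_row// muleA -EFinM; exact: sqr_g_le.
rewrite ge0_integralZl_EFin//; last 2 first.
- by move=> x Ax; apply: integral_ge0 => y By; exact: F0.
- exact: measurable_integral_onr.
rewrite fubini_tonelli_on// EFinM -muleA.
apply: lee_wpmul2l; first by rewrite lee_fin.
rewrite -ge0_integralZl_EFin//; last 2 first.
- by move=> y _; rewrite lee_fin sqr_ge0.
- by apply/measurable_EFinP; exact: measurable_funX.
apply: ge0_le_integral => //.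
- by move=> y By; apply: integral_ge0 => x Ax; exact: F0.
- exact: measurable_integral_onl.
- by apply/measurable_funeM/measurable_EFinP; exact: measurable_funX.
- move=> y By; rewrite integral_column//.
  apply: (@le_trans _ _ ((q y)%:E * (b * k y)%:E)).
    by apply: lee_wpmul2l; [rewrite lee_fin q0|exact: column_bound].
  rewrite -!EFinM lee_fin le_eqVlt; apply/orP; left; apply/eqP.
  by rewrite /q; field; rewrite gt_eqF ?k0.
Qed.

End SchurTest.

Section Modulus.
Variable R : realType.
Implicit Types x y : R[i].

Lemma cabs_normc x : cabs x = ComplexField.Normc.normc x.
Proof. by case: x. Qed.

Lemma cabs_ge0 x : 0 <= cabs x.
Proof. exact: sqrtr_ge0. Qed.

Lemma cabsM x y : cabs (x * y) = cabs x * cabs y.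
Proof. by rewrite !cabs_normc ComplexField.Normc.normcM. Qed.

Lemma cabsV x : cabs x^-1 = (cabs x)^-1.
Proof. by rewrite !cabs_normc ComplexField.Normc.normcV. Qed.

Lemma cabs0 : cabs (0 : R[i]) = 0.
Proof. by rewrite cabs_normc ComplexField.Normc.normc0. Qed.

Lemma cabs1 : cabs (1 : R[i]) = 1.
Proof. by rewrite cabs_normc ComplexField.Normc.normc1. Qed.

Lemma cabs_eq0 x : cabs x = 0 -> x = 0.
Proof. by rewrite cabs_normc; exact: ComplexField.Normc.eq0_normc. Qed.

Lemma ler_cabsD x y : cabs (x + y) <= cabs x + cabs y.
Proof. by rewrite !cabs_normc; exact: le_normcD. Qed.

Lemma cabsN x : cabs (- x) = cabs x.
Proof. by rewrite !cabs_normc normcN. Qed.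

Lemma cabs_real (r : R) : 0 <= r -> cabs (Complex r 0) = r.
Proof. by move=> r0; rewrite /cabs /= expr0n addr0 sqrtr_sqr ger0_norm. Qed.

Lemma sqr_cabs x : cabs x ^+ 2 = complex.Re x ^+ 2 + complex.Im x ^+ 2.
Proof. by rewrite sqr_sqrtr// addr_ge0 ?sqr_ge0. Qed.

Lemma cabs_conj x : cabs x^* = cabs x.
Proof. by case: x => a b; rewrite /cabs /= sqrrN. Qed.

Lemma mul_conjC x : x * x^* = Complex (cabs x ^+ 2) 0.
Proof.
rewrite sqr_cabs; case: x => a b; apply/eqP; rewrite eq_complex/=.
by apply/andP; split; apply/eqP; ring.
Qed.

Lemma Re_conj x : complex.Re x^* = complex.Re x. Proof. by case: x. Qed.
Lemma Im_conj x : complex.Im x^* = - complex.Im x. Proof. by case: x. Qed.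

Lemma ReD x y : complex.Re (x + y) = complex.Re x + complex.Re y.
Proof. by case: x; case: y. Qed.
Lemma ImD x y : complex.Im (x + y) = complex.Im x + complex.Im y.
Proof. by case: x; case: y. Qed.
Lemma ReN x : complex.Re (- x) = - complex.Re x. Proof. by case: x. Qed.
Lemma ImN x : complex.Im (- x) = - complex.Im x. Proof. by case: x. Qed.
Lemma ReM x y : complex.Re (x * y) =
  complex.Re x * complex.Re y - complex.Im x * complex.Im y.
Proof. by case: x; case: y. Qed.
Lemma ImM x y : complex.Im (x * y) =
  complex.Re x * complex.Im y + complex.Im x * complex.Re y.
Proof. by case: x => a b; case: y => c d /=; rewrite [b * c]mulrC. Qed.

Lemma complex_ext x y : complex.Re x = complex.Re y ->
  complex.Im x = complex.Im y -> x = y.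
Proof. by case: x => a b; case: y => c d /= -> ->. Qed.

Lemma ler_Re_cabs x : `|complex.Re x| <= cabs x.
Proof. by rewrite -sqrtr_sqr /cabs ler_wsqrtr// lerDl sqr_ge0. Qed.

Lemma ler_Im_cabs x : `|complex.Im x| <= cabs x.
Proof. by rewrite -sqrtr_sqr /cabs ler_wsqrtr// lerDr sqr_ge0. Qed.

Lemma cabs_le_ReIm x : cabs x <= `|complex.Re x| + `|complex.Im x|.
Proof.
rewrite -[leRHS]ger0_norm ?addr_ge0// -sqrtr_sqr ler_wsqrtr// sqrrD.
by rewrite !real_normK ?num_real// lerD2r lerDl mulrn_wge0// mulr_ge0.
Qed.

Lemma ler_dist_cabs x y : `|cabs x - cabs y| <= cabs (x - y).
Proof.
have sub_le (a b : R[i]) : cabs a - cabs b <= cabs (a - b).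
  by rewrite lerBlDr -{1}[a](subrK b) ler_cabsD.
rewrite ler_norml sub_le andbT lerNl opprB.
by rewrite (le_trans (sub_le _ _))// -cabsN opprB.
Qed.

Lemma ler_cabs_sum (I : Type) (s : seq I) (F : I -> R[i]) :
  cabs (\sum_(i <- s) F i) <= \sum_(i <- s) cabs (F i).
Proof.
elim/big_ind2: _ => [|x a y b xa yb|//]; first by rewrite cabs0.
by rewrite (le_trans (ler_cabsD _ _))// lerD.
Qed.

Lemma sqr_cabsD_le x y : cabs (x + y) ^+ 2 <= 2 * cabs x ^+ 2 + 2 * cabs y ^+ 2.
Proof.
apply: (@le_trans _ _ ((cabs x + cabs y) ^+ 2)).
  by rewrite lerXn2r ?nnegrE ?addr_ge0 ?cabs_ge0 ?ler_cabsD.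
by have := sqr_ge0 (cabs x - cabs y); nra.
Qed.

End Modulus.

Lemma le_eps_mul_le0 (R : realFieldType) (x b : R) :
  (forall e, 0 < e -> x <= e * b) -> x <= 0.
Proof.
move=> xeb; rewrite leNgt; apply/negP => x0.
have b0 : 0 < b by have := xeb 1 ltr01; rewrite mul1r; exact: lt_le_trans.
have := xeb (x / (2 * b)); rewrite divr_gt0 ?mulr_gt0// => /(_ isT).
rewrite (_ : x / _ * b = x / 2); last by field; rewrite gt_eqF.
by move=> x_half; lra.
Qed.

Lemma quadratic_ge0_le (R : realFieldType) (p x y : R) :
  0 <= p -> 0 <= x -> 0 <= y ->
  (forall s, 0 <= p * s ^+ 2 * x + y - 2 * s * p) -> p <= x * y.
Proof.
move=> p0 x0 y0 quad_ge0.
have [->|pn] := eqVneq p 0; first by rewrite mulr_ge0.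
have [x_eq0|xn] := eqVneq x 0.
  have := quad_ge0 ((y + 1) / p).
  by rewrite x_eq0 mulr0 add0r -mulrA divfK//; lra.
have xp : 0 < x by rewrite lt_def xn.
have := quad_ge0 x^-1; rewrite (_ : _ - _ = y - p / x); last by field.
by rewrite subr_ge0 ler_pdivrMr// mulrC.
Qed.

Section InnerProduct.
Variables (R : realType) (E : lmodType R[i]).
Implicit Types (H L : set E) (ip : E -> E -> R[i]).

Definition subspace H := H 0 /\ forall a x y, H x -> H y -> H (a *: x + y).

Definition linear_on (E' : lmodType R[i]) H (S : E -> E') :=
  forall a x y, H x -> H y -> S (a *: x + y) = a *: S x + S y.

Record inner_product_on H ip : Prop := InnerProductOn {
  ip_subspace : subspace H;
  ip_linear : forall a x y z, H x -> H y -> H z ->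
    ip (a *: x + y) z = a * ip x z + ip y z;
  ip_hermitian : forall x y, H x -> H y -> ip y x = (ip x y)^*;
  ip_ge0 : forall x, H x -> 0 <= complex.Re (ip x x) }.

Definition ip_norm ip x := Num.sqrt (complex.Re (ip x x)).

Definition ip_complete H ip := forall u : nat -> E, (forall k, H (u k)) ->
  (forall e : R, 0 < e -> exists N, forall k l, (N <= k)%N -> (N <= l)%N ->
    ip_norm ip (u k - u l) < e) ->
  exists2 f, H f & forall e : R, 0 < e -> exists N, forall k, (N <= k)%N ->
    ip_norm ip (u k - f) < e.

Section SubspaceTheory.
Variable H : set E.
Hypothesis subH : subspace H.

Lemma subspaceZ a x : H x -> H (a *: x).
Proof. by case: subH => H0 HDZ Hx; rewrite -[_ *: _]addr0; exact: HDZ. Qed.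

Lemma subspaceD x y : H x -> H y -> H (x + y).
Proof. by case: subH => _ HDZ Hx Hy; rewrite -[x]scale1r; exact: HDZ. Qed.

Lemma subspaceB x y : H x -> H y -> H (x - y).
Proof.
by move=> Hx Hy; apply: subspaceD => //; rewrite -scaleN1r; exact: subspaceZ.
Qed.

End SubspaceTheory.

Lemma linear_on0 (E' : lmodType R[i]) H (S : E -> E') :
  subspace H -> linear_on H S -> S 0 = 0.
Proof.
move=> [H0 _] lS; have := lS 1 0 0 H0 H0; rewrite !scale1r addr0.
by move=> /(congr1 (+%R^~ (- S 0))); rewrite subrr addrK.
Qed.

Lemma linear_onZ (E' : lmodType R[i]) H (S : E -> E') a x :
  subspace H -> linear_on H S -> H x -> S (a *: x) = a *: S x.
Proof.
move=> sH lS Hx; rewrite -[a *: x]addr0 lS//; last by case: sH.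
by rewrite (linear_on0 sH lS) addr0.
Qed.

Lemma linear_onB (E' : lmodType R[i]) H (S : E -> E') x y :
  subspace H -> linear_on H S -> H x -> H y -> S (x - y) = S x - S y.
Proof.
move=> sH lS Hx Hy; rewrite addrC -scaleN1r lS//.
by rewrite scaleN1r addrC.
Qed.

Section InnerProductTheory.
Variables (H : set E) (ip : E -> E -> R[i]).
Hypothesis ipH : inner_product_on H ip.
Local Notation sqn x := (complex.Re (ip x x)).

Let subH := ip_subspace ipH.

Lemma linear_on_ipl z : H z -> linear_on H (ip^~ z : E -> R[i]^o).
Proof. by move=> Hz a x y Hx Hy; exact: (ip_linear ipH). Qed.

Lemma ip0l z : H z -> ip 0 z = 0.
Proof. by move=> /linear_on_ipl; exact: linear_on0. Qed.

Lemma ip0r z : H z -> ip z 0 = 0.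
Proof. by move=> Hz; rewrite (ip_hermitian ipH subH.1 Hz) ip0l// rmorph0. Qed.

Lemma ipZl a x z : H x -> H z -> ip (a *: x) z = a * ip x z.
Proof. by move=> Hx /linear_on_ipl lz; exact: (linear_onZ a subH lz Hx). Qed.

Lemma ipBl x y z : H x -> H y -> H z -> ip (x - y) z = ip x z - ip y z.
Proof.
by move=> Hx Hy /linear_on_ipl lz; exact: (linear_onB subH lz Hx Hy).
Qed.

Lemma ip_linear_r a x y z : H x -> H y -> H z ->
  ip z (a *: x + y) = a^* * ip z x + ip z y.
Proof.
move=> Hx Hy Hz; rewrite (ip_hermitian ipH _ Hz); last exact: subH.2.
by rewrite (ip_linear ipH)// rmorphD rmorphM/= -!(ip_hermitian ipH).
Qed.

Lemma ipZr a x z : H x -> H z -> ip z (a *: x) = a^* * ip z x.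
Proof.
move=> Hx Hz; rewrite (ip_hermitian ipH _ Hz); last exact: subspaceZ.
by rewrite ipZl// rmorphM/= -(ip_hermitian ipH).
Qed.

Lemma Re_ip_linear a x y : H x -> H y ->
  sqn (a *: x + y) = cabs a ^+ 2 * sqn x + sqn y + 2 * complex.Re (a * ip x y).
Proof.
move=> Hx Hy; have Hxy := subH.2 a x y Hx Hy.
rewrite (ip_linear ipH)// !ip_linear_r// (ip_hermitian ipH Hx Hy).
rewrite !mulrDr mulrA mul_conjC sqr_cabs.
rewrite !(ReD, ReM, ImM, ImD, Re_conj, Im_conj)/=; ring.
Qed.

Lemma ip_norm_ge0 x : 0 <= ip_norm ip x.
Proof. exact: sqrtr_ge0. Qed.

Lemma sqr_ip_norm x : H x -> ip_norm ip x ^+ 2 = sqn x.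
Proof. by move=> Hx; rewrite sqr_sqrtr// (ip_ge0 ipH). Qed.

Section Energy.
Variables (L : set E) (phi : E -> R[i]).
Hypotheses (subL : subspace L) (LH : L `<=` H).
Hypothesis phi_antilinear :
  forall a x y, L x -> L y -> phi (a *: x + y) = a^* * phi x + phi y.

Definition energy x := sqn x - 2 * complex.Re (phi x).

Lemma energy_line a x y : L x -> L y ->
  energy (a *: x + y) =
  energy y + cabs a ^+ 2 * sqn x + 2 * complex.Re (a^* * (ip y x - phi x)).
Proof.
move=> Lx Ly; have Hx := LH Lx; have Hy := LH Ly.
rewrite /energy Re_ip_linear// phi_antilinear// (ip_hermitian ipH Hy Hx).
by rewrite !(ReD, ReM, ReN, ImD, ImN, Re_conj, Im_conj)/=; ring.
Qed.

Variable m : R.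
Hypothesis energy_ge : forall x, L x -> m <= energy x.

(* Minimality of the energy along the line through [x] in direction [y]. *)
Lemma near_minimizer_defect_le e x : L x -> energy x <= m + e ->
  forall y, L y -> cabs (ip x y - phi y) ^+ 2 <= sqn y * e.
Proof.
move=> Lx Jx y Ly; set D := ip x y - phi y.
have e0 : 0 <= e by have := energy_ge Lx; lra.
apply: quadratic_ge0_le => //; first exact: sqr_ge0.
  by apply: (ip_ge0 ipH); exact: LH.
move=> s; have := energy_ge (subL.2 (- (Complex s 0 * D)) _ _ Ly Lx).
rewrite energy_line// -/D cabsN cabsM exprMn [cabs (Complex _ _) ^+ 2]sqr_cabs.
have -> : complex.Re ((- (Complex s 0 * D))^* * D) = - (s * cabs D ^+ 2).
  by rewrite sqr_cabs !(ReN, ReM, ImM, ImN, Re_conj, Im_conj)/=; ring.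
by rewrite /= expr0n addr0; lra.
Qed.

Lemma near_minimizers_close e x y :
  L x -> L y -> energy x <= m + e -> energy y <= m + e ->
  sqn (x - y) <= 4 * e.
Proof.
move=> Lx Ly Jx Jy; have Lxy := subspaceB subL Lx Ly.
have := near_minimizer_defect_le Lx Jx Lxy.
have := near_minimizer_defect_le Ly Jy Lxy.
set X := ip x _ - _; set Y := ip y _ - _ => Y_le X_le.
have N0 : 0 <= sqn (x - y) by apply: (ip_ge0 ipH); exact: LH.
have NXY : sqn (x - y) <= cabs (X - Y).
  have -> : X - Y = ip (x - y) (x - y).
    by rewrite ipBl; [rewrite /X /Y; ring|exact: LH..].
  exact: le_trans (ler_norm _) (ler_Re_cabs _).
have sqrN : sqn (x - y) ^+ 2 <= 4 * e * sqn (x - y).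
  have := sqr_cabsD_le X (- Y); rewrite cabsN => XY_le.
  have : sqn (x - y) ^+ 2 <= cabs (X - Y) ^+ 2.
    by rewrite lerXn2r ?nnegrE ?cabs_ge0.
  by lra.
have e0 : 0 <= e by have := energy_ge Lx; lra.
have [->|Nn] := eqVneq (sqn (x - y)) 0; first by rewrite mulr_ge0.
by move: sqrN; rewrite expr2 ler_pM2r// lt_def Nn.
Qed.

End Energy.

Lemma cauchy_schwarz x y : H x -> H y -> cabs (ip x y) ^+ 2 <= sqn y * sqn x.
Proof.
move=> Hx Hy; pose zero (_ : E) : R[i] := 0.
have zero_antilinear a u v :
    H u -> H v -> zero (a *: u + v) = a^* * zero u + zero v.
  by rewrite /zero mulr0 addr0.
have energy0 u : energy zero u = sqn u by rewrite /energy/= mulr0 subr0.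
rewrite -[ip x y]subr0.
apply: (@near_minimizer_defect_le H zero subH (fun _ => id)
  zero_antilinear 0) => //.
  by move=> u Hu; rewrite energy0 (ip_ge0 ipH).
by rewrite energy0 add0r.
Qed.

Section Riesz.
Hypothesis H_complete : ip_complete H ip.
Variables (L : set E) (phi : E -> R[i]) (c : R).
Hypotheses (subL : subspace L) (LH : L `<=` H).
Hypothesis phi_antilinear :
  forall a x y, L x -> L y -> phi (a *: x + y) = a^* * phi x + phi y.

Section MinimizingSequence.
Variables (u : nat -> E) (m : R).
Hypothesis energy_ge_m : forall x, L x -> m <= energy phi x.
Hypothesis Lu : forall k, L (u k).
Hypothesis energy_u : forall k, energy phi (u k) <= m + k.+1%:R^-1.

Let invS_lt (e : R) : 0 < e -> exists N, N.+1%:R^-1 < e.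
Proof. by move=> /ltr_add_invr[N]; rewrite add0r; exists N. Qed.

Let energy_tail_le N k : (N <= k)%N -> energy phi (u k) <= m + N.+1%:R^-1.
Proof.
move=> Nk; apply: (le_trans (energy_u k)).
by rewrite lerD2l lef_pV2 ?posrE// ler_nat.
Qed.

Lemma minimizing_sequence_cvg : exists2 F, H F &
  forall e : R, 0 < e -> exists N, forall k, (N <= k)%N ->
    ip_norm ip (u k - F) < e.
Proof.
apply: H_complete => [k|e e0]; first exact: LH.
have [|N Ne] := @invS_lt (e ^+ 2 / 4); first by rewrite divr_gt0 ?exprn_gt0.
exists N => k l /energy_tail_le uk /energy_tail_le ul.
rewrite -(@ltr_pXn2r _ 2)// ?nnegrE ?ip_norm_ge0 ?(ltW e0)//.
rewrite sqr_ip_norm; last by apply: LH; exact: subspaceB.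
apply: (le_lt_trans
  (near_minimizers_close subL LH phi_antilinear energy_ge_m _ _ uk ul)) => //.
by rewrite mulrC -ltr_pdivlMr.
Qed.

Lemma minimizing_limit_represents F : H F ->
  (forall e : R, 0 < e -> exists N, forall k, (N <= k)%N ->
    ip_norm ip (u k - F) < e) ->
  forall y, L y -> ip F y = phi y.
Proof.
move=> HF uF y Ly; have Hy := LH Ly.
suff : cabs (ip F y - phi y) ^+ 2 <= 0.
  move=> sqr_le0; apply/eqP; rewrite -subr_eq0; apply/eqP/cabs_eq0/eqP.
  by rewrite -sqrf_eq0 eq_le sqr_le0 sqr_ge0.
apply: (le_eps_mul_le0 (b := 4 * sqn y)) => e e0.
have [N1 Ne] := invS_lt e0.
have [|N2 uFe] := uF (Num.sqrt e); first by rewrite sqrtr_gt0.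
pose k := maxn N1 N2.
have HuF : H (u k - F) by apply: subspaceB => //; exact: LH.
have -> : ip F y - phi y = (ip (u k) y - phi y) + - ip (u k - F) y.
  by rewrite ipBl//; [ring|exact: LH].
apply: (le_trans (sqr_cabsD_le _ _)); rewrite cabsN.
have := near_minimizer_defect_le subL LH phi_antilinear energy_ge_m (Lu k)
  (energy_tail_le (leq_maxl N1 N2)) Ly.
have := cauchy_schwarz HuF Hy.
have : sqn (u k - F) <= e.
  rewrite -sqr_ip_norm// -(sqr_sqrtr (ltW e0)).
  by rewrite lerXn2r ?nnegrE ?ip_norm_ge0 ?sqrtr_ge0// ltW ?uFe// leq_maxr.
have := ip_ge0 ipH Hy.
by move: Ne; move: (N1.+1%:R^-1 : R) => i ie y0 uFk cs defect; nra.
Qed.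

End MinimizingSequence.

Hypothesis c0 : 0 <= c.
Hypothesis phi_bounded : forall x, L x -> cabs (phi x) ^+ 2 <= c * sqn x.

Let energy_ge x : L x -> - c <= energy phi x.
Proof.
move=> Lx; have N0 := ip_ge0 ipH (LH Lx).
have : complex.Re (phi x) ^+ 2 <= c * sqn x.
  by apply: le_trans (phi_bounded Lx); rewrite sqr_cabs lerDl sqr_ge0.
rewrite /energy; move: (complex.Re (phi x)) => r sqr_r.
suff : 2 * r <= c + sqn x by lra.
apply: (@le_trans _ _ `|2 * r|); first exact: ler_norm.
rewrite -(@ler_pXn2r _ 2)// ?nnegrE ?addr_ge0// real_normK ?num_real//.
by have := sqr_ge0 (c - sqn x); nra.
Qed.

Theorem riesz_on_subspace : exists2 F, H F & forall y, L y -> ip F y = phi y.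
Proof.
pose values := energy phi @` L.
have values_inf : has_inf values.
  split; first by exists (energy phi 0), 0 => //; exact: subL.1.
  by exists (- c) => _ [x Lx <-]; exact: energy_ge.
have inf_le x : L x -> inf values <= energy phi x.
  by move=> Lx; apply: ge_inf; [case: values_inf|exists x].
have /choice[u u_near_inf] k :
    exists x, L x /\ energy phi x < inf values + k.+1%:R^-1.
  have k0 : 0 < k.+1%:R^-1 :> R by rewrite invr_gt0.
  by have [_ [x Lx <-]] := inf_adherent k0 values_inf; exists x.
have Lu k : L (u k) by case: (u_near_inf k).
have energy_u k : energy phi (u k) <= inf values + k.+1%:R^-1.
  by apply: ltW; case: (u_near_inf k).
have [F HF uF] := minimizing_sequence_cvg inf_le Lu energy_u.
exists F => //.
exact: (minimizing_limit_represents inf_le Lu energy_u HF uF).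
Qed.

End Riesz.
End InnerProductTheory.
End InnerProduct.

Section EuclideanTopology.
Variables (R : realType) (n : nat).
Local Notation V := (Cn R n).
Local Notation B := (CBorel R n).
Implicit Types (U Om : set V) (z : V).

Lemma vnorm_ge0 (h : V) : 0 <= vnorm h. Proof. exact: sqrtr_ge0. Qed.

Lemma cabs_le_vnorm (h : V) j : cabs (h ord0 j) <= vnorm h.
Proof.
rewrite -[leLHS]ger0_norm ?cabs_ge0// -sqrtr_sqr ler_wsqrtr//.
by rewrite (bigD1 j)//= lerDl sumr_ge0// => i _; rewrite sqr_ge0.
Qed.

Lemma vnorm_lt (h : V) (e : R) : 0 < e ->
  (forall j, cabs (h ord0 j) <= e / n.+1%:R) -> vnorm h < e.
Proof.
move=> e0 he; rewrite -(@ltr_pXn2r _ 2)// ?nnegrE ?vnorm_ge0 ?(ltW e0)//.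
rewrite sqr_sqrtr; last by rewrite sumr_ge0// => j _; rewrite sqr_ge0.
apply: (@le_lt_trans _ _ (\sum_(j < n) (e / n.+1%:R) ^+ 2)).
  apply: ler_sum => j _.
  by rewrite lerXn2r ?nnegrE ?cabs_ge0 ?divr_ge0 ?(ltW e0).
rewrite sumr_const card_ord -[_ *+ n]mulr_natl expr_div_n mulrCA.
rewrite gtr_pMr ?exprn_gt0//.
rewrite ltr_pdivrMr ?exprn_gt0// mul1r -natrX ltr_nat.
by rewrite -mulnn leq_pmulr.
Qed.

Lemma Copen_measurable U : Copen U -> measurable (U : set B).
Proof. by move=> oU; exact: sub_sigma_algebra. Qed.

Definition continuous_at_Cn (g : V -> R) z := forall e : R, 0 < e ->
  exists2 delta : R, 0 < delta &
    forall y, vnorm (y - z) < delta -> `|g y - g z| < e.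

Lemma Copen_superlevel Om (g : V -> R) t : Copen Om ->
  (forall z, Om z -> continuous_at_Cn g z) -> Copen (Om `&` [set z | t < g z]).
Proof.
move=> openOm cg z [Oz tz]; have [e e0 ball_Om] := openOm z Oz.
have [|delta delta0 near_gz] := cg z Oz (g z - t); first by rewrite subr_gt0.
exists (Num.min e delta); first by rewrite lt_min e0.
move=> y; rewrite lt_min => /andP[/ball_Om Oy /near_gz].
by rewrite ltr_norml => /andP[+ _]; split => //=; lra.
Qed.

Lemma lower_semicontinuous_measurable Om (g : V -> R) : Copen Om ->
  (forall t, Copen (Om `&` [set z | t < g z])) ->
  measurable_fun (Om : set B) (g : B -> R).
Proof.
move=> openOm cg; apply: (measurability _ (RGenOInfty.measurableE R)).
move=> _ [_ [t ->] <-]; rewrite -/(Om `&` _) preimage_itvoy.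
exact: Copen_measurable.
Qed.

Lemma continuous_measurable_Cn Om (g : V -> R) : Copen Om ->
  (forall z, Om z -> continuous_at_Cn g z) ->
  measurable_fun (Om : set B) (g : B -> R).
Proof.
move=> openOm cg; apply: lower_semicontinuous_measurable => // t.
exact: Copen_superlevel.
Qed.

Lemma holo_on_continuous Om (f : V -> R[i]) z : holo_on Om f -> Om z ->
  forall e : R, 0 < e -> exists2 delta : R, 0 < delta &
    forall y, vnorm (y - z) < delta -> cabs (f y - f z) < e.
Proof.
move=> hf Oz e e0; have [a ha] := hf z Oz.
have [d d0 hd] := ha 1 ltr01.
pose S := 1 + \sum_(j < n) cabs (a ord0 j).
have S0 : 0 < S by rewrite ltr_pwDl// sumr_ge0// => j _; exact: cabs_ge0.
exists (Num.min d (e / S)); first by rewrite lt_min d0 divr_gt0.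
move=> y; rewrite lt_min => /andP[/hd + ye].
rewrite [z + _](_ : _ = y :> V); last by rewrite addrC subrK.
set L := \sum_(j < n) _; move=> f_sub_L.
have L_le : cabs L <= (\sum_(j < n) cabs (a ord0 j)) * vnorm (y - z).
  rewrite (le_trans (ler_cabs_sum _ _))// mulr_suml ler_sum// => j _.
  by rewrite cabsM ler_wpM2l ?cabs_ge0// cabs_le_vnorm.
rewrite -[f y - f z](subrK L) (le_lt_trans (ler_cabsD _ _))//.
apply: (le_lt_trans (lerD f_sub_L L_le)).
by rewrite -mulrDl -/S mulrC -ltr_pdivlMr.
Qed.

Lemma holo_on_lipschitz_comp Om (f : V -> R[i]) (l : R[i] -> R) z :
  (forall x y, `|l x - l y| <= cabs (x - y)) -> holo_on Om f -> Om z ->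
  continuous_at_Cn (l \o f) z.
Proof.
move=> ll hf Oz e e0; have [d d0 hd] := holo_on_continuous hf Oz e0.
by exists d => // y /hd; apply: le_lt_trans; exact: ll.
Qed.

Lemma Copen_holo_map_preimage Om (F : V -> V) U :
    Copen Om -> holo_map_on Om F ->
  Copen U -> Copen (Om `&` F @^-1` U).
Proof.
move=> openOm hF oU z [Oz Uz].
have [e e0 ball_U] := oU _ Uz; have [r r0 ball_Om] := openOm z Oz.
have en0 : 0 < e / n.+1%:R by rewrite divr_gt0.
have /choice[dl hdl] (j : 'I_n) : exists delta : R, 0 < delta /\
    forall y, vnorm (y - z) < delta ->
      cabs (F y ord0 j - F z ord0 j) < e / n.+1%:R.
  by have [d d0 hd] := holo_on_continuous (hF j) Oz en0; exists d.
pose D := \big[Num.min/r]_(j < n) dl j.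
exists D.
  apply: (big_ind (fun x => 0 < x)) => // [x y x0 y0|j _];
    last by case: (hdl j).
  by rewrite lt_min x0.
move=> y yD; split.
  by apply/ball_Om/(lt_le_trans yD); exact: bigmin_le_id.
apply/ball_U/vnorm_lt => // j; rewrite !mxE.
apply/ltW/(hdl j).2/(lt_le_trans yD).
exact: bigmin_le_cond.
Qed.

End EuclideanTopology.

Section Caratheodory.
Variables (R : realType) (n : nat).
Local Notation V := (Cn R n).
Local Notation B := (CBorel R n).

Definition box (x : V) (e : R) : set V :=
  [set z | forall j, cabs (z ord0 j - x ord0 j) < e].

Lemma Copen_box (x : V) (e : R) : Copen (box x e).
Proof.
move=> z zx.
pose D := \big[Num.min/1]_(j < n) (e - cabs (z ord0 j - x ord0 j)).
exists D.
  apply: (big_ind (fun x => 0 < x)) => // [a b a0 b0|j _].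
    by rewrite lt_min a0.
  by rewrite subr_gt0; exact: zx.
move=> y yD j.
rewrite (_ : _ - _ = (y - z) ord0 j + (z ord0 j - x ord0 j)); last first.
  by rewrite !mxE addrA subrK.
rewrite (le_lt_trans (ler_cabsD _ _))// -ltrBrDr.
apply/(le_lt_trans (cabs_le_vnorm _ _))/(lt_le_trans yD).
exact: bigmin_le_cond.
Qed.

Lemma le_box (x : V) (d e : R) : d <= e -> box x d `<=` box x e.
Proof. by move=> de z zx j; exact: lt_le_trans (zx j) de. Qed.

Lemma box_vnorm_lt (x z : V) (e : R) :
  0 < e -> box x (e / n.+1%:R) z -> vnorm (x - z) < e.
Proof.
by move=> e0 zx; apply: vnorm_lt => // j; rewrite !mxE -cabsN opprB ltW.
Qed.

Definition rat_point (u : 'rV[rat * rat]_n) : V :=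
  \row_j Complex (ratr (u ord0 j).1) (ratr (u ord0 j).2).

Lemma rat_point_dense (z : V) (e : R) :
    0 < e -> exists u, box (rat_point u) e z.
Proof.
move=> e0.
have rat_near (r : R) : exists q : rat, `|r - ratr q| < e / 2.
  have [|q] := @rat_in_itvoo R (r - e / 2) (r + e / 2); first lra.
  by rewrite in_itv/= => /andP[q1 q2]; exists q; rewrite ltr_norml; lra.
have /choice[u hu] (j : 'I_n) : exists q : rat * rat,
    cabs (z ord0 j - Complex (ratr q.1) (ratr q.2)) < e.
  have [q1 near_q1] := rat_near (complex.Re (z ord0 j)).
  have [q2 near_q2] := rat_near (complex.Im (z ord0 j)).
  exists (q1, q2); apply: (le_lt_trans (cabs_le_ReIm _)).
  by rewrite ReD ImD ReN ImN/=; lra.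
by exists (\row_j u j) => j; rewrite !mxE.
Qed.

Lemma Copen_dense_seq (Om : set V) : Copen Om -> Om !=set0 ->
  exists u : nat -> V, (forall i, Om (u i)) /\
    forall z (e : R), Om z -> 0 < e -> exists i, box (u i) e z.
Proof.
move=> openOm [z0 Oz0].
pose point i := if unpickle i is Some r then rat_point r else z0.
exists (fun i => if point i \in Om then point i else z0); split.
  by move=> i; case: ifPn => // /set_mem.
move=> z e Oz e0; have [d d0 ball_Om] := openOm z Oz.
have r0 : 0 < Num.min e (d / n.+1%:R) by rewrite lt_min e0 divr_gt0.
have [r zr] := rat_point_dense z r0.
have Or : Om (rat_point r).
  by apply/ball_Om/box_vnorm_lt => //; apply: le_box zr;
    rewrite ge_min lexx orbT.
exists (pickle r); rewrite /point pickleK mem_set//.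
by apply: le_box zr; rewrite ge_min lexx.
Qed.

Lemma continuous_gt_dense_seqP (g : V -> R) (u : nat -> V) (z : V) (t : R) :
  continuous_at_Cn g z ->
  (forall e : R, 0 < e -> exists i, box (u i) e z) ->
  t < g z <-> exists m k : nat, forall i,
    box (u i) k.+1%:R^-1 z -> t + m.+1%:R^-1 <= g (u i).
Proof.
move=> cg u_dense; split=> [/ltr_add_invr[m tm]|[m [k le_g]]].
  have [|r r0 near_z] := cg (g z - (t + m.+1%:R^-1)); first by rewrite subr_gt0.
  have [k] := ltr_add_invr (divr_gt0 r0 (ltr0Sn R n)); rewrite add0r => kr.
  exists m, k => i zi.
  have /near_z : vnorm (u i - z) < r by apply/box_vnorm_lt/(le_box (ltW kr)).
  by rewrite ltr_norml opprB ltrD2r => /andP[/ltW].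
have m0 : 0 < m.+1%:R^-1 :> R by rewrite invr_gt0.
have [r r0 near_z] := cg _ m0.
have [|i zi] := u_dense (Num.min k.+1%:R^-1 (r / n.+1%:R)).
  by rewrite lt_min invr_gt0 ltr0Sn divr_gt0.
have /near_z : vnorm (u i - z) < r.
  by apply/box_vnorm_lt => //; apply: le_box zi; rewrite ge_min lexx orbT.
have := le_g i (le_box _ zi); rewrite ge_min lexx => /(_ isT) tg.
rewrite ltr_norml => /andP[_].
by rewrite ltrBlDr addrC => /(le_lt_trans tg); rewrite ltrD2r.
Qed.

(* By [continuous_gt_dense_seqP], the superlevel sets of [N] are countable
   combinations of measurable rectangles. *)
Lemma caratheodory_measurable d (Y : measurableType d) (Om : set V) (D : set Y)
    (N : V -> Y -> R) : Copen Om -> measurable D ->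
  (forall z, Om z -> measurable_fun D (N z)) ->
  (forall z y, Om z -> D y -> continuous_at_Cn (N^~ y) z) ->
  measurable_fun ((Om : set B) `*` D) (fun x => N x.1 x.2).
Proof.
move=> openOm mD mN cN; have mOm := Copen_measurable openOm.
have [Om0|/set0P Om_neq0] := eqVneq Om set0.
  by rewrite Om0 set0X; exact: measurable_fun_set0.
have [u [Ou u_dense]] := Copen_dense_seq openOm Om_neq0.
apply: (measurability _ (RGenOInfty.measurableE R)) => _ [_ [t ->] <-].
pose A (m k i : nat) : set (B * Y) :=
  ((Om `\` box (u i) k.+1%:R^-1) `*` D) `|`
  (Om `*` (D `&` [set y | t + m.+1%:R^-1 <= N (u i) y])).
have AE m k i z y : A m k i (z, y) <-> (Om z /\ D y) /\
    (box (u i) k.+1%:R^-1 z -> t + m.+1%:R^-1 <= N (u i) y).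
  split=> [[[[Oz nz] Dy]|[Oz [Dy le_N]]]|[[Oz Dy] le_N]] //.
  by have [/le_N|] := pselect (box (u i) k.+1%:R^-1 z); [right|left].
rewrite (_ : _ `&` _ = \bigcup_m \bigcup_k \bigcap_i A m k i).
  apply: bigcupT_measurable => m; apply: bigcupT_measurable => k.
  apply: bigcapT_measurable => i; apply: measurableU; apply: measurableX => //.
    by apply: measurableD => //; apply: Copen_measurable; exact: Copen_box.
  by rewrite -preimage_itvcy; apply: mN => //; exact: measurable_itv.
apply/seteqP; split=> [[z y] [/= [Oz Dy]]|[z y] [m _ [k _ zy]]].
  rewrite in_itv/= andbT.
  move=> /(continuous_gt_dense_seqP t (cN z y Oz Dy) (u_dense z ^~ Oz)).
  move=> [m [k le_N]].
  by exists m => //; exists k => // i _; apply/AE; split => //; exact: le_N.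
have [[Oz Dy] _] := (AE m k 0%N z y).1 (zy 0%N I).
split => //; rewrite /= in_itv/= andbT.
apply/(continuous_gt_dense_seqP t (cN z y Oz Dy) (u_dense z ^~ Oz)).
by exists m, k => i; have [_] := (AE m k i z y).1 (zy i I).
Qed.

End Caratheodory.

Section ComplexIntegral.
Variables (R : realType) (n : nat)
  (sigma : {measure set (CBorel R n) -> \bar R}).
Variable D : set (CBorel R n).
Hypothesis mD : measurable D.
Implicit Types h : Cn R n -> R[i].

Definition cintegrable h :=
  sigma.-integrable D (fun x => (complex.Re (h x))%:E) /\
  sigma.-integrable D (fun x => (complex.Im (h x))%:E).

Lemma cintegrableZ a h : cintegrable h -> cintegrable (fun x => a * h x).
Proof.
move=> [ir ii]; split.
  under eq_fun do rewrite ReM EFinB !EFinM.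
  by apply: integrableB => //; exact: integrableZl.
under eq_fun do rewrite ImM EFinD !EFinM.
by apply: integrableD => //; exact: integrableZl.
Qed.

Lemma cintegralD h1 h2 : cintegrable h1 -> cintegrable h2 ->
  cintegral sigma D (fun x => h1 x + h2 x) =
  cintegral sigma D h1 + cintegral sigma D h2.
Proof.
move=> [r1 i1] [r2 i2]; apply: complex_ext; rewrite ?ReD ?ImD /=.
  by under eq_Rintegral do rewrite ReD; rewrite RintegralD.
by under eq_Rintegral do rewrite ImD; rewrite RintegralD.
Qed.

Lemma cintegralZ a h : cintegrable h ->
  cintegral sigma D (fun x => a * h x) = a * cintegral sigma D h.
Proof.
move=> [ir ii].
have iZ (c : R) (g : Cn R n -> R) : sigma.-integrable D (fun x => (g x)%:E) ->
    sigma.-integrable D (fun x => (c * g x)%:E).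
  by move=> ig; under eq_fun do rewrite EFinM; exact: integrableZl.
apply: complex_ext; rewrite ?ReM ?ImM /=.
  under eq_Rintegral do rewrite ReM.
  by rewrite RintegralB ?RintegralZl//; exact: iZ.
under eq_Rintegral do rewrite ImM.
by rewrite RintegralD ?RintegralZl//; exact: iZ.
Qed.

Lemma measurable_cabs h : measurable_fun D (fun x => complex.Re (h x)) ->
  measurable_fun D (fun x => complex.Im (h x)) ->
  measurable_fun D (fun x => cabs (h x)).
Proof.
by move=> mr mi; apply/measurable_fun_sqrt/measurable_funD;
  exact: measurable_funX.
Qed.

(* Rotating the integral onto the positive real axis reduces the inequality to
   real parts. *)
Lemma le_cabs_cintegral h : cintegrable h ->
  ((cabs (cintegral sigma D h))%:E <= \int[sigma]_(x in D) (cabs (h x))%:E)%E.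
Proof.
move=> ih; set c := cintegral sigma D h.
have [->|cn] := eqVneq c 0.
  by rewrite cabs0 integral_ge0// => x _; rewrite lee_fin cabs_ge0.
have cc : cabs c != 0 by apply: contraNneq cn => /cabs_eq0 ->.
pose u := Complex (cabs c)^-1 0 * c^*.
have u1 : cabs u = 1.
  by rewrite cabsM cabs_conj cabs_real ?invr_ge0 ?cabs_ge0// mulVf.
have uc : complex.Re (u * c) = cabs c.
  rewrite /u -mulrA [_^* * _]mulrC mul_conjC ReM/= mulr0 subr0.
  by rewrite expr2 mulrA mulVf// mul1r.
have [iur _] := cintegrableZ u ih; have [mr mi] := ih.
have mcabs : measurable_fun D (fun x => (cabs (h x))%:E).
  apply/measurable_EFinP; apply: (measurable_cabs (h := h)).
    by have /measurable_EFinP := measurable_int _ mr.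
  by have /measurable_EFinP := measurable_int _ mi.
rewrite -uc /c -cintegralZ//=; apply: (@le_trans _ _
  (\int[sigma]_(x in D) `|(complex.Re (u * h x))%:E|)%E).
  apply: le_trans (le_abse_integral _ mD (measurable_int _ iur)).
  by rewrite /Rintegral fineK ?lee_abs//; exact: integrable_fin_num.
apply: ge0_le_integral => //.
- by apply: measurableT_comp => //; exact: measurable_int _ iur.
- move=> x _; rewrite abse_EFin lee_fin -[leRHS]mul1r -u1 -cabsM.
  exact: ler_Re_cabs.
Qed.

End ComplexIntegral.

Section HoloOn.
Variables (R : realType) (n : nat) (Om : set (Cn R n)).

Lemma holo_on_cst_on (c : R[i]) (f : Cn R n -> R[i]) : Copen Om ->
  (forall z, Om z -> f z = c) -> holo_on Om f.
Proof.
move=> openOm fc z Oz; have [e e0 he] := openOm z Oz.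
exists 0 => e' e'0; exists e => // h hh.
rewrite !fc//; last first.
  by apply: he; rewrite [X in vnorm X](_ : _ = h)// addrC addKr.
rewrite subrr big1 ?subr0 ?cabs0 ?mulr_ge0 ?vnorm_ge0 ?ltW// => j _.
by rewrite mxE mul0r.
Qed.

Lemma holo_on_linear (a : R[i]) (f g : Cn R n -> R[i]) :
  holo_on Om f -> holo_on Om g -> holo_on Om (fun w => a * f w + g w).
Proof.
move=> hf hg z Oz; have [A hA] := hf z Oz; have [A' hA'] := hg z Oz.
exists (a *: A + A') => e e0.
have c0 : 0 < cabs a + 1 by rewrite ltr_wpDl// cabs_ge0.
have e1 : 0 < e / (cabs a + 1) by rewrite divr_gt0.
have [df df0 hdf] := hA _ e1; have [dg dg0 hdg] := hA' _ e1.
exists (Num.min df dg); first by rewrite lt_min df0.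
move=> h; rewrite lt_min => /andP[/hdf f_le /hdg g_le].
have -> : \sum_(j < n) (a *: A + A') ord0 j * h ord0 j =
    a * \sum_(j < n) A ord0 j * h ord0 j + \sum_(j < n) A' ord0 j * h ord0 j.
  rewrite mulr_sumr -big_split/=; apply: eq_bigr => j _.
  by rewrite !mxE mulrDl mulrA.
rewrite (_ : _ - _ = a * (f (z + h) - f z - \sum_(j < n) A ord0 j * h ord0 j) +
  (g (z + h) - g z - \sum_(j < n) A' ord0 j * h ord0 j)); last by ring.
rewrite (le_trans (ler_cabsD _ _))// cabsM.
apply: (le_trans (lerD (ler_wpM2l (cabs_ge0 a) f_le) g_le)).
by rewrite le_eqVlt; apply/orP; left; apply/eqP; field; rewrite gt_eqF.
Qed.

End HoloOn.

Section BergmanSpace.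
Variables (R : realType) (n : nat)
  (sigma : {measure set (CBorel R n) -> \bar R}).
Variable Om : set (Cn R n).
Hypothesis openOm : Copen Om.
Local Notation C := R[i].
Local Notation V := (Cn R n).
Local Notation B := (CBorel R n).
Local Notation OmB := (Om : set B).
Local Notation Bs := (Bspace sigma Om).
Local Notation ip := (inner sigma Om).

Let mOm : measurable OmB. Proof. exact: Copen_measurable. Qed.

Lemma Bspace_measurable_comp f (l : C -> R) :
  (forall x y, `|l x - l y| <= cabs (x - y)) ->
  Bs f -> measurable_fun OmB (fun w : B => l (f w)).
Proof.
move=> ll [hf _]; apply: continuous_measurable_Cn => // z.
exact: (holo_on_lipschitz_comp ll hf).
Qed.

Lemma Bspace_measurable_Re f : Bs f ->
  measurable_fun OmB (fun w : B => complex.Re (f w)).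
Proof.
by apply: Bspace_measurable_comp => x y; rewrite -ReN -ReD; exact: ler_Re_cabs.
Qed.

Lemma Bspace_measurable_Im f : Bs f ->
  measurable_fun OmB (fun w : B => complex.Im (f w)).
Proof.
by apply: Bspace_measurable_comp => x y; rewrite -ImN -ImD; exact: ler_Im_cabs.
Qed.

Lemma Bspace_measurable_cabs f : Bs f ->
  measurable_fun OmB (fun w : B => cabs (f w)).
Proof. by apply: Bspace_measurable_comp; exact: ler_dist_cabs. Qed.

Lemma Bspace_integrable_sqr f : Bs f ->
  sigma.-integrable OmB (fun x => (cabs (f x) ^+ 2)%:E).
Proof.
move=> Bf; have [_ [_ fi]] := Bf; apply/integrableP; split.
  by apply/measurable_EFinP; apply: measurable_funX;
    exact: Bspace_measurable_cabs.
by under eq_integral do rewrite gee0_abs ?lee_fin ?sqr_ge0//.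
Qed.

Lemma Bspace_integrable_mul f g : Bs f -> Bs g ->
  sigma.-integrable OmB (fun x => (cabs (f x) * cabs (g x))%:E).
Proof.
move=> Bf Bg.
apply: (@le_integrable _ _ _ _ _ mOm _
   (fun x => (cabs (f x) ^+ 2)%:E + (cabs (g x) ^+ 2)%:E)%E).
- apply/measurable_EFinP; apply: measurable_funM; exact: Bspace_measurable_cabs.
- move=> x _; rewrite -EFinD !gee0_abs ?lee_fin ?addr_ge0 ?sqr_ge0 ?mulr_ge0//;
    rewrite ?cabs_ge0//.
  have := sqr_ge0 (cabs (f x) - cabs (g x)).
  by have := sqr_ge0 (cabs (f x) + cabs (g x)); nra.
- by apply: integrableD => //; exact: Bspace_integrable_sqr.
Qed.

Lemma cintegrable_inner f g : Bs f -> Bs g ->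
  cintegrable sigma OmB (fun x => f x * (g x)^*).
Proof.
move=> Bf Bg; have ifg := Bspace_integrable_mul Bf Bg.
have mRe := Bspace_measurable_Re; have mIm := Bspace_measurable_Im.
have bound (x y : R) (z : C) : x <= cabs z -> cabs z = y -> x <= `|y|.
  by move=> xz <-; rewrite ger0_norm ?cabs_ge0.
have cabs_fg x : cabs (f x * (g x)^*) = cabs (f x) * cabs (g x).
  by rewrite cabsM cabs_conj.
split; apply: le_integrable ifg => //; first 1 last.
- by move=> x _; rewrite lee_fin; exact: bound (ler_Re_cabs _) (cabs_fg x).
- apply/measurable_EFinP; under eq_fun do rewrite ImM Re_conj Im_conj mulrN.
  by apply: measurable_funD; [apply: measurableT_comp => //|];
    apply: measurable_funM; auto.
- by move=> x _; rewrite lee_fin; exact: bound (ler_Im_cabs _) (cabs_fg x).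
- apply/measurable_EFinP.
  under eq_fun do rewrite ReM Re_conj Im_conj mulrN opprK.
  by apply: measurable_funD; apply: measurable_funM; auto.
Qed.

Lemma L2norm_ge0 f : 0 <= L2norm sigma Om f.
Proof. exact: sqrtr_ge0. Qed.

Lemma EFin_sqr_L2norm f : Bs f ->
  (L2norm sigma Om f ^+ 2)%:E = (\int[sigma]_(x in OmB) (cabs (f x) ^+ 2)%:E)%E.
Proof.
move=> Bf; have int0 : (0 <= \int[sigma]_(x in OmB) (cabs (f x) ^+ 2)%:E)%E.
  by apply: integral_ge0 => x _; rewrite lee_fin sqr_ge0.
rewrite sqr_sqrtr ?fine_ge0// fineK//; apply: integrable_fin_num => //.
exact: Bspace_integrable_sqr.
Qed.

Lemma Re_inner_self f : complex.Re (ip f f) =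
  fine (\int[sigma]_(x in OmB) (cabs (f x) ^+ 2)%:E)%E.
Proof. by congr fine; apply: eq_integral => x _; rewrite mul_conjC. Qed.

Lemma L2norm_inner f : L2norm sigma Om f = ip_norm ip f.
Proof. by rewrite /ip_norm Re_inner_self. Qed.

Lemma Bspace_subspace : subspace (Bs : set (V -> C)).
Proof.
split=> [|a f g Bf Bg].
  split; first exact: (holo_on_cst_on (c := 0) openOm).
  split => //; rewrite integral0_eq// => x _.
  by rewrite cabs0 expr0n.
have [hf [f0 _]] := Bf; have [hg [g0 _]] := Bg.
have hol : holo_on Om (a *: f + g) := holo_on_linear a hf hg.
split => //; split=> [w nw|].
  by rewrite -[LHS]/(a * f w + g w) f0// g0// mulr0 addr0.
apply: integrable_lty => //.
apply: (@le_integrable _ _ _ _ _ mOm _ (fun x =>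
  (2 * cabs a ^+ 2)%:E * (cabs (f x) ^+ 2)%:E + 2%:E * (cabs (g x) ^+ 2)%:E)%E).
- apply/measurable_EFinP; apply: measurable_funX.
  apply: (continuous_measurable_Cn openOm) => z.
  by apply: holo_on_lipschitz_comp hol; exact: ler_dist_cabs.
- move=> x _; rewrite -!EFinM -EFinD !gee0_abs ?lee_fin ?addr_ge0 ?mulr_ge0//;
    rewrite ?sqr_ge0 ?cabs_ge0//.
  by have := sqr_cabsD_le (a * f x) (g x); rewrite cabsM exprMn mulrA.
- apply: integrableD => //; apply: integrableZl => //;
    exact: Bspace_integrable_sqr.
Qed.

Lemma Bspace_inner_product : inner_product_on (Bs : set (V -> C)) ip.
Proof.
split=> [|a f g h Bf Bg Bh|f g Bf Bg|f Bf].
- exact: Bspace_subspace.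
- rewrite /inner -cintegralZ//; last exact: cintegrable_inner.
  rewrite -cintegralD//; last exact: cintegrable_inner.
    by congr cintegral; apply/funext => x; rewrite mulrDl -mulrA.
  by apply: cintegrableZ => //; exact: cintegrable_inner.
- have [_ ii] := cintegrable_inner Bf Bg.
  apply: complex_ext; rewrite ?Re_conj ?Im_conj/=.
    by apply: eq_Rintegral => x _; rewrite !ReM !Re_conj !Im_conj; ring.
  rewrite -mulN1r -RintegralZl//.
  by apply: eq_Rintegral => x _; rewrite !ImM !Re_conj !Im_conj; ring.
- rewrite Re_inner_self fine_ge0// integral_ge0// => x _.
  by rewrite lee_fin sqr_ge0.
Qed.

Lemma Bspace_complete : Bcomplete sigma Om ->
    ip_complete (Bs : set (V -> C)) ip.
Proof.
have normE : ip_norm ip = L2norm sigma Om.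
  by apply/funext => f; rewrite L2norm_inner.
by move=> Bc u Bu; rewrite normE; exact: Bc.
Qed.

Lemma cabs_inner_le f g : Bs f -> Bs g ->
  cabs (ip f g) <= L2norm sigma Om f * L2norm sigma Om g.
Proof.
move=> Bf Bg; rewrite !L2norm_inner -(@ler_pXn2r _ 2)//; last 2 first.
- by rewrite nnegrE cabs_ge0.
- by rewrite nnegrE mulr_ge0 ?ip_norm_ge0.
rewrite exprMn !(sqr_ip_norm Bspace_inner_product)// mulrC.
exact: (cauchy_schwarz Bspace_inner_product).
Qed.

Lemma cabs_inner_le_integral f g : Bs f -> Bs g ->
  ((cabs (ip f g))%:E <= \int[sigma]_(x in OmB) (cabs (f x) * cabs (g x))%:E)%E.
Proof.
move=> Bf Bg.
apply: le_trans (le_cabs_cintegral mOm (cintegrable_inner Bf Bg)) _.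
by under eq_integral do rewrite cabsM cabs_conj.
Qed.

End BergmanSpace.

Section PowerWeights.
Variable R : realType.
Implicit Types b c p q t x y beta : R.

Lemma powR_expR x r : 0 < x -> x `^ r = expR (r * ln x).
Proof. by move=> x0; rewrite /powR gt_eqF. Qed.

Lemma hoelder_factor_powR t x b p : 0 <= t -> 0 < x -> 0 < b -> 0 < p ->
  (t / x * b `^ ((2 - p) / p)) `^ p = t `^ p * x `^ (- p) * b `^ (2 - p).
Proof.
move=> t0 x0 b0 p0; rewrite powRM ?divr_ge0 ?powR_ge0 ?(ltW x0)//.
rewrite powRM ?invr_ge0 ?(ltW x0)// -powR_inv1 ?(ltW x0)// -!powRrM mulN1r.
by rewrite divfK// gt_eqF.
Qed.

Lemma conjugate_factor_powR x b p q beta :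
  0 < x -> 0 < b -> 1 < p -> q = p / (p - 1) ->
  (x `^ (- beta / q) * b `^ ((p - 2) / p)) `^ q = b `^ (2 - q) * x `^ (- beta).
Proof.
move=> x0 b0 p1 ->; have p0 : 0 < p by exact: lt_trans p1.
have p10 : 0 < p - 1 by rewrite subr_gt0.
rewrite powRM ?powR_ge0// -!powRrM mulrC; congr (_ `^ _ * _ `^ _).
  by field; rewrite !gt_eqF.
by field; rewrite !gt_eqF.
Qed.

Lemma hoelder_factors_mul t x b p a : 0 < x -> 0 < b -> 0 < p ->
  t / x * b `^ ((2 - p) / p) * (x `^ (a - 1) * b `^ ((p - 2) / p)) * x ^+ 2 =
  t * x `^ a.
Proof.
move=> x0 b0 p0.
have -> : b `^ ((p - 2) / p) = (b `^ ((2 - p) / p))^-1.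
  by rewrite -powRN; congr (_ `^ _); ring.
have -> : x `^ a = x `^ (a - 1) * x.
  rewrite -[X in _ * X](powRr1 (ltW x0)) -powRD ?subrK//.
  by rewrite (gt_eqF x0) implybT.
by field; rewrite !gt_eqF ?powR_gt0.
Qed.

Lemma rudin_forelli_integrand x y b c beta : 0 < x -> 0 < y -> 0 < b ->
  (b * (y * x)) `^ ((c + beta + (c - beta)) / 2) /
    (y `^ (c - beta) * x `^ (c + beta)) =
  y `^ beta * (b `^ c * x `^ (- beta)).
Proof.
move=> x0 y0 b0; rewrite invfM -!powRN !powR_expR ?mulr_gt0//.
by rewrite !lnM ?posrE ?mulr_gt0// -!expRD; congr expR; field.
Qed.

Lemma involuted_weight_le t x y b b' c p :
  0 <= t -> 0 < x -> 0 < y -> 0 < b -> 0 < b' -> 0 < c -> 2 <= p ->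
  y^-1 <= c * b -> x^-1 <= c * b' ->
  t `^ p * y `^ (- p) * b' `^ (2 - p) * x ^+ 2 <=
  c `^ (2 * p - 2) * (t * (b * x)) `^ p.
Proof.
move=> t0 x0 y0 b0 b'0 c0 p2 y_le x_le.
have p0 : 0 <= p by apply: le_trans p2.
have weight_y : y `^ (- p) <= (c * b) `^ p.
  rewrite -[- p]mulN1r powRrM powR_inv1 ?(ltW y0)//.
  apply: ge0_ler_powR => //; rewrite nnegrE ?invr_ge0 ?(ltW y0)//.
  by rewrite mulr_ge0 ?(ltW c0) ?(ltW b0).
have weight_b' : b' `^ (2 - p) <= (c * x) `^ (p - 2).
  rewrite (_ : 2 - p = -1 * (p - 2)); last by ring.
  rewrite powRrM powR_inv1 ?(ltW b'0)//.
  apply: ge0_ler_powR; rewrite ?subr_ge0 ?nnegrE ?invr_ge0 ?(ltW b'0)//.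
    by rewrite mulr_ge0 ?(ltW c0) ?(ltW x0).
  by rewrite -div1r ler_pdivrMr// mulrAC -ler_pdivrMr// div1r.
rewrite powRM ?mulr_ge0 ?(ltW b0) ?(ltW x0)//.
have -> : c `^ (2 * p - 2) * (t `^ p * (b * x) `^ p) =
    t `^ p * (c * b) `^ p * (c * x) `^ (p - 2) * x ^+ 2.
  move: (t `^ p) => tau.
  rewrite -(powR_mulrn 2 (ltW x0)) !powR_expR ?mulr_gt0// !lnM ?posrE//.
  rewrite mulrCA -!mulrA.
  by congr (_ * _); rewrite -!expRD; congr expR; ring.
rewrite ler_wpM2r ?sqr_ge0// ler_pM ?mulr_ge0 ?powR_ge0//.
by rewrite ler_wpM2l ?powR_ge0.
Qed.

End PowerWeights.

Section ReproducingKernel.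
Variables (R : realType) (n : nat)
  (sigma : {measure set (CBorel R n) -> \bar R}).
Variables (Om : set (Cn R n)) (K : Cn R n -> Cn R n -> R[i]).
Hypothesis openOm : Copen Om.
Hypothesis sigma_fin : (sigma setT < +oo)%E.
Hypothesis repK : reproducing_kernel sigma Om K.
Local Notation C := R[i].
Local Notation V := (Cn R n).
Local Notation B := (CBorel R n).
Local Notation OmB := (Om : set B).
Local Notation Bs := (Bspace sigma Om : set (V -> C)).
Local Notation ip := (inner sigma Om).
Local Notation KN := (Knorm sigma Om K).
Local Notation k_ := (nkernel sigma Om K).
Local Notation ks := (kspan sigma Om K : set (V -> C)).
Local Notation scalar r := (Complex r 0).

Let mOm : measurable OmB. Proof. exact: Copen_measurable. Qed.
Let ipB := Bspace_inner_product sigma openOm.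
Let subB := Bspace_subspace sigma openOm.

Lemma Bspace_kernel z : Om z -> Bs (K z).
Proof. by case: repK => + _; exact. Qed.

Lemma reproducing f z : Bs f -> Om z -> f z = ip f (K z).
Proof. by case: repK => _ + Bf; exact. Qed.

Lemma Bspace_indicator : Bs (fun w => (w \in Om)%:R).
Proof.
split; first by apply: (holo_on_cst_on (c := 1) openOm) => z Oz;
  rewrite mem_set.
split; first by move=> w nw; rewrite memNset.
rewrite (eq_integral (cst 1%:E)) => [|x xO]; last by rewrite xO cabs1 expr1n.
rewrite integral_cst// mul1e; apply: le_lt_trans sigma_fin.
by apply: le_measure; rewrite ?inE.
Qed.

Lemma Knorm_gt0 z : Om z -> 0 < KN z.
Proof.
move=> Oz; rewrite lt_def L2norm_ge0 andbT; apply/negP => /eqP KN0.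
have := cabs_inner_le openOm Bspace_indicator (Bspace_kernel Oz).
rewrite -(reproducing Bspace_indicator Oz) mem_set// -/(KN z) KN0 mulr0.
by rewrite cabs1 ler10.
Qed.

Let KN_gt0 := Knorm_gt0.

Lemma kernel_nkernel z : Om z -> K z = scalar (KN z) *: k_ z.
Proof.
move=> Oz; apply/funext => w.
rewrite -[RHS]/(scalar (KN z) * k_ z w) /nkernel mulrC divfK//.
apply/eqP => /(congr1 (@complex.Re R)) /= KN0.
by have := KN_gt0 Oz; rewrite KN0 ltxx.
Qed.

Lemma nkernel_kernel z : k_ z = (scalar (KN z))^-1 *: K z.
Proof. by apply/funext => w; rewrite -[RHS]/(_^-1 * K z w) mulrC. Qed.

Lemma Bspace_nkernel z : Om z -> Bs (k_ z).
Proof.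
by move=> Oz; rewrite nkernel_kernel; exact/(subspaceZ subB)/Bspace_kernel.
Qed.

Lemma cabs_eval_le f z : Bs f -> Om z -> cabs (f z) <= L2norm sigma Om f * KN z.
Proof.
move=> Bf Oz; rewrite (reproducing Bf Oz).
exact: cabs_inner_le (Bspace_kernel Oz).
Qed.

Lemma cabs_kernel_diag z : Om z -> cabs (K z z) = KN z ^+ 2.
Proof.
move=> Oz; have BK := Bspace_kernel Oz.
apply/le_anti; rewrite {1}expr2 cabs_eval_le//= (reproducing BK Oz).
rewrite /Knorm L2norm_inner (sqr_ip_norm ipB)//.
exact: le_trans (ler_norm _) (ler_Re_cabs _).
Qed.

Lemma kspan_subspace : subspace ks.
Proof.
split; first by exists [::]; split => //; apply/funext => w; rewrite big_nil.
move=> a f g [s [hs ->]] [t [ht ->]].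
exists ([seq (a * x.1, x.2) | x <- s] ++ t); split.
  by move=> x; rewrite mem_cat => /orP[/mapP[y /hs Oy ->]|/ht].
apply/funext => w; rewrite big_cat big_map -[LHS]/(a * _ + _) mulr_sumr.
congr (_ + _).
by apply: eq_bigr => x _; rewrite mulrA.
Qed.

Lemma kspan_nkernel z : Om z -> ks (k_ z).
Proof.
move=> Oz; exists [:: (1, z)]; split; first by move=> x; rewrite inE => /eqP ->.
by apply/funext => w; rewrite big_seq1 mul1r.
Qed.

Lemma kspan_kernel z : Om z -> ks (K z).
Proof.
move=> Oz; rewrite kernel_nkernel//.
exact/(subspaceZ kspan_subspace)/kspan_nkernel.
Qed.

Lemma kspan_ind (P : (V -> C) -> Prop) : P 0 ->
  (forall a z f, Om z -> ks f -> P f -> P (a *: k_ z + f)) ->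
  forall f, ks f -> P f.
Proof.
move=> P0 PS f [s [hs ->]]; elim: s hs => [|[a z] s IH] hs.
  by rewrite (_ : (fun _ => _) = 0)//; apply/funext => w; rewrite big_nil.
have Os x : x \in s -> Om x.2 by move=> xs; apply: hs; rewrite inE xs orbT.
rewrite (_ : (fun _ => _) = a *: k_ z +
    (fun w => \sum_(x <- s) x.1 * k_ x.2 w)).
  by apply: PS; [exact: (hs (a, z) (mem_head _ _)) | exists s | exact: IH].
by apply/funext => w; rewrite big_cons.
Qed.

Lemma kspan_sub_Bspace : ks `<=` Bs.
Proof.
apply: kspan_ind; first by case: subB.
by move=> a z f Oz _ Bf; apply: subB.2 => //; exact: Bspace_nkernel.
Qed.

(* [KN w] is the supremum of [|f w|] over the unit ball of [Bs], hence lower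
   semicontinuous in the Euclidean topology; its continuity for the metric of
   (A.2) is of no help here, as open sets of that metric need not be Borel. *)
Lemma measurable_Knorm : measurable_fun OmB (KN : B -> R).
Proof.
apply: lower_semicontinuous_measurable => // t.
have [t0|t0] := ltP t 0.
  rewrite (_ : _ `&` _ = Om)//; apply/seteqP; split => [x []//|x Ox].
  by split => //=; apply: lt_trans t0 _; exact: KN_gt0.
move=> z [Oz /= tz].
have [hK _] := Bspace_kernel Oz.
have oU := @Copen_superlevel R n Om (fun w => cabs (K z w)) (t * KN z) openOm
  (fun w => holo_on_lipschitz_comp (@ler_dist_cabs R) hK).
have [|e e0 he] := oU z.
  split => //=; rewrite cabs_kernel_diag//.
  by rewrite expr2 ltr_pM2r ?KN_gt0.
exists e => // y /he[Oy /= ty]; split => //=.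
have := cabs_eval_le (Bspace_kernel Oz) Oy.
by rewrite -/(KN z) => /(lt_le_trans ty);
  rewrite mulrC ltr_pM2l ?KN_gt0.
Qed.

Let sqr_KN := (fun w => KN w ^+ 2) \_ OmB.

Let measurable_sqr_KN : measurable_fun [set: B] sqr_KN.
Proof.
by apply/(measurable_restrictT _ mOm)/measurable_funX; exact: measurable_Knorm.
Qed.

Let sqr_KN_ge0 w : 0 <= sqr_KN w.
Proof. by rewrite /sqr_KN patchE; case: ifPn => // _; exact: sqr_ge0. Qed.

Definition lambda_measure : {measure set B -> \bar R} :=
  density sigma measurable_sqr_KN sqr_KN_ge0.

Lemma lambda_measureE (E : set B) :
  E `<=` Om -> lambda_measure E = lambda sigma Om K E.
Proof.
move=> EO; apply: eq_integral => w /set_mem Ew.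
by rewrite /sqr_KN patchE mem_set//; exact: EO.
Qed.

Lemma integral_lambda (g : B -> R) : measurable_fun OmB g ->
  (forall w, Om w -> 0 <= g w) ->
  (\int[lambda_measure]_(w in OmB) (g w)%:E =
   \int[sigma]_(w in OmB) (g w * KN w ^+ 2)%:E)%E.
Proof.
move=> mg g0; rewrite integral_density//; last exact/measurable_EFinP.
by apply: eq_integral => w Ow; rewrite /sqr_KN patchE Ow.
Qed.

Definition kernel_correlation z w := cabs (ip (k_ z) (k_ w)).

Local Notation kcorr := kernel_correlation.

Lemma cabs_kernel z w : Om z -> Om w ->
    cabs (K z w) = kcorr z w * (KN z * KN w).
Proof.
move=> Oz Ow; have Bkz := Bspace_nkernel Oz; have Bkw := Bspace_nkernel Ow.
rewrite (reproducing (Bspace_kernel Oz) Ow) (kernel_nkernel Oz)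
  (kernel_nkernel Ow).
rewrite (ipZl ipB)//; last exact: (subspaceZ subB).
rewrite (ipZr ipB)// !cabsM cabs_conj !cabs_real ?(ltW (KN_gt0 _))//.
by rewrite /kcorr; ring.
Qed.

Lemma cabs_nkernel z w : Om z -> Om w -> cabs (k_ z w) = kcorr z w * KN w.
Proof.
move=> Oz Ow; rewrite /nkernel cabsM cabsV cabs_real ?(ltW (KN_gt0 Oz))//.
by rewrite cabs_kernel//; field; rewrite gt_eqF ?KN_gt0.
Qed.

Lemma measurable_kernel_correlation z : Om z ->
  measurable_fun OmB (kcorr z : B -> R).
Proof.
move=> Oz; have mk := Bspace_measurable_cabs openOm (Bspace_nkernel Oz).
apply: (@eq_measurable_fun _ _ _ _ _ (fun w : B => cabs (k_ z w) / KN w)).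
  by move=> w /set_mem Ow; rewrite cabs_nkernel// mulfK// gt_eqF ?KN_gt0.
apply: measurable_funM => //; apply: measurable_funV_gt0 => //.
exact: measurable_Knorm.
Qed.

Definition kspan_operator (S : (V -> C) -> V -> C) :=
  linear_on ks S /\ forall f, ks f -> Bs (S f).

Definition adjoint_on_kernels S S' := forall z w, Om z -> Om w ->
  ip (S (k_ z)) (k_ w) = ip (k_ z) (S' (k_ w)).

Definition row_bounded a A (S : (V -> C) -> V -> C) := forall z, Om z ->
  (\int[sigma]_(w in OmB) (cabs (S (K z) w) * KN w `^ a)%:E <=
    (A * KN z `^ a)%:E)%E.

Lemma adjoint_on_kernels_sym S S' : kspan_operator S -> kspan_operator S' ->
  adjoint_on_kernels S S' -> adjoint_on_kernels S' S.
Proof.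
move=> [_ BS] [_ BS'] adj z w Oz Ow; have BS'k := BS' _ (kspan_nkernel Oz).
have BSk := BS _ (kspan_nkernel Ow).
rewrite (ip_hermitian ipB (Bspace_nkernel Ow) BS'k) -adj//.
by rewrite -(ip_hermitian ipB BSk (Bspace_nkernel Oz)).
Qed.

Definition has_bounded_extension (T : (V -> C) -> V -> C) :=
  exists S : (V -> C) -> (V -> C),
    (forall f, Bs f -> Bs (S f)) /\ linear_on Bs S /\
    (exists c : R, forall f, Bs f ->
       L2norm sigma Om (S f) <= c * L2norm sigma Om f) /\
    (forall f, ks f -> S f = T f).

Section Adjoint.
Variables S S' : (V -> C) -> V -> C.
Hypotheses (opS : kspan_operator S) (opS' : kspan_operator S').
Hypothesis adj : adjoint_on_kernels S S'.

Lemma adjoint_on_kspan f g : ks f -> ks g -> ip (S f) g = ip f (S' g).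
Proof.
have [lS BS] := opS; have [lS' BS'] := opS'.
have ksB := kspan_sub_Bspace; have kk := kspan_nkernel;
  have Bk := Bspace_nkernel.
have adj_nkernel z h : Om z -> ks h -> ip (S (k_ z)) h = ip (k_ z) (S' h).
  move=> Oz kh; have BSz := BS _ (kk _ Oz).
  move: h kh; apply: kspan_ind => [|b w h Ow kh IH].
    by rewrite (linear_on0 kspan_subspace lS') !(ip0r ipB)//; exact: Bk.
  rewrite lS'; [|exact: kk|exact: kh].
  rewrite (ip_linear_r ipB b (Bk _ Ow) (ksB _ kh) BSz).
  rewrite (ip_linear_r ipB b (BS' _ (kk _ Ow)) (BS' _ kh) (Bk _ Oz)).
  by rewrite adj// IH.
move=> kf kg; move: f kf; apply: kspan_ind => [|a z f Oz kf IH].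
  by rewrite (linear_on0 kspan_subspace lS) !(ip0l ipB)//;
    [exact: BS'|exact: ksB].
rewrite lS; [|exact: kk|exact: kf].
rewrite (ip_linear ipB a (BS _ (kk _ Oz)) (BS _ kf) (ksB _ kg)).
by rewrite (ip_linear ipB a (Bk _ Oz) (ksB _ kf) (BS' _ kg)) adj_nkernel// IH.
Qed.

Lemma adjoint_eval f z : ks f -> Om z -> S f z = ip f (S' (K z)).
Proof.
move=> kf Oz; rewrite (reproducing (opS.2 _ kf) Oz).
by rewrite adjoint_on_kspan//; exact: kspan_kernel.
Qed.

Lemma cabs_adjoint_kernel z w :
  Om z -> Om w -> cabs (S' (K z) w) = cabs (S (K w) z).
Proof.
move=> Oz Ow; rewrite (adjoint_eval (kspan_kernel Ow) Oz).
have BS'z := opS'.2 _ (kspan_kernel Oz).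
rewrite (ip_hermitian ipB BS'z (Bspace_kernel Ow)) cabs_conj.
by rewrite -(reproducing BS'z Ow).
Qed.

Lemma measurable_adjoint_kernel :
  measurable_fun (OmB `*` OmB) (fun u => cabs (S' (K u.1) u.2)).
Proof.
apply: (@caratheodory_measurable R n _ B Om Om
    (fun z w => cabs (S' (K z) w))) => //.
  move=> z Oz; apply: (Bspace_measurable_cabs openOm).
  exact: opS'.2 _ (kspan_kernel Oz).
move=> z w Oz Ow e e0; have [holSw _] := opS.2 _ (kspan_kernel Ow).
have [r r0 ball_Om] := openOm Oz.
have [delta delta0 near_z] :=
  holo_on_lipschitz_comp (@ler_dist_cabs R) holSw Oz e0.
exists (Num.min r delta); first by rewrite lt_min r0.
move=> y; rewrite lt_min => /andP[/ball_Om Oy /near_z].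
by rewrite /= !cabs_adjoint_kernel.
Qed.

Variables a A A' : R.
Hypotheses (A0 : 0 <= A) (A'0 : 0 <= A').
Hypotheses (rowS : row_bounded a A S) (rowS' : row_bounded a A' S').

Lemma adjoint_transform_bound f F : Bs f -> Bs F ->
  (forall z, Om z -> F z = ip f (S' (K z))) ->
  L2norm sigma Om F ^+ 2 <= A' * A * L2norm sigma Om f ^+ 2.
Proof.
move=> Bf BF FE; rewrite -lee_fin (EFinM (A' * A)) !EFin_sqr_L2norm//.
have Om_fin : (sigma OmB < +oo)%E.
  by apply: le_lt_trans sigma_fin; apply: le_measure; rewrite ?inE.
pose mu : {finite_measure set B -> \bar R} := mfrestr mOm Om_fin.
have muE (g : B -> \bar R) :
    (\int[mu]_(w in OmB) g w = \int[sigma]_(w in OmB) g w)%E.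
  by apply: eq_measure_integral => E mE EO; rewrite /= /mfrestr /mrestr setIidl.
have mKNa : measurable_fun OmB (fun w : B => KN w `^ a).
  exact: (measurableT_comp (measurable_powR a) measurable_Knorm).
have KNa_gt0 w : Om w -> 0 < KN w `^ a by move=> Ow; rewrite powR_gt0 ?KN_gt0.
rewrite -!muE.
apply: (@schur_test _ _ B B R mu mu Om Om (fun z w => cabs (S' (K z) w))
  (fun z => KN z `^ a) (fun w => KN w `^ a)) => //.
- exact: measurable_adjoint_kernel.
- by move=> z w _ _; exact: cabs_ge0.
- by move=> z Oz; rewrite muE rowS'.
- move=> w Ow; rewrite muE.
  rewrite (eq_integral (fun z : B => (cabs (S (K w) z) * KN z `^ a)%:E)).
    exact: rowS.
  by move=> z /set_mem Oz; rewrite cabs_adjoint_kernel.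
- exact: (Bspace_measurable_cabs openOm Bf).
- exact: (Bspace_measurable_cabs openOm BF).
- by move=> w _; exact: cabs_ge0.
- by move=> z _; exact: cabs_ge0.
- move=> z Oz; rewrite muE FE//; under eq_integral do rewrite mulrC.
  by apply: (cabs_inner_le_integral openOm Bf);
    exact: opS'.2 _ (kspan_kernel Oz).
Qed.

End Adjoint.

Section Extension.
Hypothesis complete_B : Bcomplete sigma Om.
Variables T Tstar : (V -> C) -> V -> C.
Hypotheses (opT : kspan_operator T) (opTstar : kspan_operator Tstar).
Hypothesis adj : adjoint_on_kernels T Tstar.
Variables a A A' : R.
Hypotheses (A0 : 0 <= A) (A'0 : 0 <= A').
Hypotheses (rowT : row_bounded a A T) (rowTstar : row_bounded a A' Tstar).

(* [F] is the Riesz representative of the functional [g |-> <f, T* g>] on the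
   span of the kernels. *)
Lemma adjoint_transform_in_Bspace f : Bs f ->
  exists2 F, Bs F & forall z, Om z -> F z = ip f (Tstar (K z)).
Proof.
move=> Bf; have [lTs BTs] := opTstar.
have Tstar_bound g : ks g ->
    L2norm sigma Om (Tstar g) ^+ 2 <= A * A' * L2norm sigma Om g ^+ 2.
  move=> kg; have adj' := adjoint_on_kernels_sym opT opTstar adj.
  apply: (adjoint_transform_bound opTstar opT adj' A'0 A0 rowTstar rowT).
  - exact: kspan_sub_Bspace.
  - exact: BTs.
  - by move=> z Oz; exact: (adjoint_eval opTstar opT adj').
have antilinear b g h : ks g -> ks h ->
    ip f (Tstar (b *: g + h)) = b^* * ip f (Tstar g) + ip f (Tstar h).
  by move=> kg kh; rewrite lTs// (ip_linear_r ipB b (BTs _ kg) (BTs _ kh) Bf).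
have bounded g : ks g -> cabs (ip f (Tstar g)) ^+ 2 <=
    L2norm sigma Om f ^+ 2 * (A * A') * complex.Re (ip g g).
  move=> kg; rewrite -(sqr_ip_norm ipB (kspan_sub_Bspace kg)) -L2norm_inner.
  apply: (@le_trans _ _
    (L2norm sigma Om f ^+ 2 * L2norm sigma Om (Tstar g) ^+ 2)).
    rewrite -exprMn lerXn2r ?nnegrE ?cabs_ge0 ?mulr_ge0 ?L2norm_ge0//.
    by apply: cabs_inner_le => //; exact: BTs.
  by rewrite -mulrA ler_wpM2l ?sqr_ge0 ?Tstar_bound.
have [|F BF FE] := riesz_on_subspace ipB (Bspace_complete complete_B)
    kspan_subspace kspan_sub_Bspace antilinear _ bounded.
  exact: mulr_ge0 (sqr_ge0 _) (mulr_ge0 A0 A'0).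
exists F => // z Oz; have kz := kspan_kernel Oz.
by rewrite (reproducing BF Oz) FE.
Qed.

Theorem bounded_extension : has_bounded_extension T.
Proof.
pose S (f : V -> C) z := if z \in Om then ip f (Tstar (K z)) else 0.
have SE f z : Om z -> S f z = ip f (Tstar (K z)).
  by move=> Oz; rewrite /S mem_set.
have S_off f z : ~ Om z -> S f z = 0 by move=> Oz; rewrite /S memNset.
have BTsK z : Om z -> Bs (Tstar (K z)).
  by move=> Oz; exact: opTstar.2 _ (kspan_kernel Oz).
have BS f : Bs f -> Bs (S f).
  move=> Bf; have [F BF FE] := adjoint_transform_in_Bspace Bf.
  rewrite (_ : S f = F)//; apply/funext => z.
  have [Oz|nOz] := pselect (Om z); first by rewrite SE// FE.
  by have [_ [F0 _]] := BF; rewrite S_off// F0.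
exists S; split => //; split; last split.
- move=> b f g Bf Bg; apply/funext => z; rewrite -[RHS]/(b * S f z + S g z).
  have [Oz|nOz] := pselect (Om z); last by rewrite !S_off// mulr0 addr0.
  by rewrite !SE// (ip_linear ipB b Bf Bg (BTsK _ Oz)).
- exists (Num.sqrt (A' * A)) => f Bf.
  have AA0 : 0 <= A' * A by rewrite mulr_ge0.
  rewrite -(@ler_pXn2r _ 2)// ?nnegrE ?mulr_ge0 ?L2norm_ge0 ?sqrtr_ge0//.
  rewrite exprMn (sqr_sqrtr AA0).
  apply: (adjoint_transform_bound opT opTstar adj A0 A'0 rowT rowTstar Bf);
    first exact: BS.
  by move=> z Oz; rewrite SE.
- move=> f kf; apply/funext => z; have [Oz|nOz] := pselect (Om z).
    by rewrite SE// (adjoint_eval opT opTstar adj).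
  by have [_ [T0 _]] := opT.2 _ kf; rewrite S_off// T0.
Qed.

End Extension.

Section Translation.
Variables (phi : V -> V -> V) (lambda_const corr_const : R).
Hypothesis phi_Om : forall z w, Om z -> Om w -> Om (phi z w).
Hypothesis phiK : forall z w, Om z -> Om w -> phi z (phi z w) = w.
Hypothesis holo_phi : forall z, Om z -> holo_map_on Om (phi z).
Hypothesis lambda_quasi_invariant : forall z (E : set V), Om z ->
  measurable (E : set B) -> E `<=` Om ->
  (lambda sigma Om K E <= lambda_const%:E * lambda sigma Om K (phi z @` E))%E.
Hypothesis kernel_correlation_ge : forall z w, Om z -> Om w ->
  (KN (phi z w))^-1 <= corr_const * kcorr z w.

Lemma measurable_phi z : Om z -> measurable_fun OmB (phi z : B -> B).
Proof.
move=> Oz; apply: (@measurability _ _ B B _ _ (@Copen R n) erefl).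
move=> _ [U oU <-].
by apply: Copen_measurable; apply: Copen_holo_map_preimage => //;
  exact: holo_phi.
Qed.

Let corr_bound_gt0 z w : Om z -> Om w -> 0 < corr_const * kcorr z w.
Proof.
move=> Oz Ow; apply: lt_le_trans (kernel_correlation_ge Oz Ow).
by rewrite invr_gt0 KN_gt0//; exact: phi_Om.
Qed.

Lemma kernel_correlation_gt0 z w : Om z -> Om w -> 0 < kcorr z w.
Proof.
move=> Oz Ow; rewrite lt_def cabs_ge0 andbT; apply/eqP => kcorr0.
by have := corr_bound_gt0 Oz Ow; rewrite kcorr0 mulr0 ltxx.
Qed.

Let kcorr_gt0 := kernel_correlation_gt0.

Let corr_const_gt0 z : Om z -> 0 < corr_const.
Proof.
by move=> Oz; have := corr_bound_gt0 Oz Oz; rewrite pmulr_lgt0// kcorr_gt0.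
Qed.

Lemma lambda_involution_le z (H : B -> R) : Om z ->
  measurable_fun OmB H -> (forall w, Om w -> 0 <= H w) ->
  (\int[lambda_measure]_(w in OmB) (H w)%:E <=
   `|lambda_const|%:E * \int[lambda_measure]_(w in OmB) (H (phi z w))%:E)%E.
Proof.
move=> Oz mH H0.
apply: (@ge0_le_integral_involution _ B R lambda_measure Om (phi z)
  `|lambda_const| mOm (measurable_phi Oz) _ _ (normr_ge0 lambda_const) _
    (EFin \o H)).
- by move=> w; exact: phi_Om.
- by move=> w; exact: phiK.
- move=> E mE EO; rewrite !lambda_measureE//; last first.
    by move=> _ [w /EO Ow <-]; exact: phi_Om.
  apply: (le_trans (lambda_quasi_invariant Oz mE EO)); apply: lee_wpmul2r.
    by apply: integral_ge0 => w _; rewrite lee_fin sqr_ge0.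
  by rewrite lee_fin ler_norm.
- exact/measurable_EFinP.
- by move=> w Ow; rewrite lee_fin H0.
Qed.

Section HoelderEstimate.
Variable p : R.
Hypothesis p2 : 2 < p.

Local Notation transl_norm z t :=
  (Lnorm sigma p%:E (fun w => (cabs (transl sigma Om K phi z t w))%:E)).

Let p0 : 0 < p. Proof. exact: lt_trans p2. Qed.

Let measurable_powR_comp (r : R) (f : B -> R) : measurable_fun OmB f ->
  measurable_fun OmB (fun w => f w `^ r).
Proof. by move=> mf; exact: (measurableT_comp (measurable_powR r) mf). Qed.

Definition weighted_density z (t : V -> C) w :=
  cabs (t w) `^ p * KN w `^ (- p) * kcorr z w `^ (2 - p).

Lemma measurable_weighted_density z t : Om z -> Bs t ->
  measurable_fun OmB (weighted_density z t : B -> R).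
Proof.
move=> Oz Bt; apply: measurable_funM; last first.
  by apply: measurable_powR_comp; exact: measurable_kernel_correlation.
apply: measurable_funM; apply: measurable_powR_comp.
  exact: (Bspace_measurable_cabs openOm Bt).
exact: measurable_Knorm.
Qed.

Lemma integral_transl_powR z t : Om z ->
  (\int[sigma]_(w in OmB) (cabs (transl sigma Om K phi z t w) `^ p)%:E =
   transl_norm z t `^ p)%E.
Proof.
have p_neq0 : p != 0 by rewrite gt_eqF.
move=> Oz; rewrite (poweR_Lnorm sigma _ p_neq0) [LHS]integral_mkcond.
apply: eq_integral => w _; rewrite patchE; case: ifPn => [_|/negP nO] /=.
  by rewrite ger0_norm ?cabs_ge0.
have [_ [k0 _]] := Bspace_nkernel Oz; rewrite /transl k0 => [|Ow]; last first.
  by apply: nO; rewrite mem_set.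
by rewrite mulr0 cabs0 normr0 powR0 ?gt_eqF.
Qed.

Lemma weighted_density_involution_le z t u : Om z -> Om u ->
  weighted_density z t (phi z u) * KN u ^+ 2 <=
  corr_const `^ (2 * p - 2) * cabs (transl sigma Om K phi z t u) `^ p.
Proof.
move=> Oz Ou; have Oy := phi_Om Oz Ou.
rewrite /transl cabsM cabs_nkernel//; apply: involuted_weight_le.
- exact: cabs_ge0.
- exact: KN_gt0.
- exact: KN_gt0.
- exact: kcorr_gt0.
- exact: kcorr_gt0.
- exact: corr_const_gt0 Oz.
- exact: ltW.
- exact: kernel_correlation_ge.
- by have := kernel_correlation_ge Oz Oy; rewrite phiK.
Qed.

Lemma translated_Lp_le z t M : Om z -> Bs t ->
  (transl_norm z t <= M%:E)%E ->
  (\int[lambda_measure]_(w in OmB) (weighted_density z t w)%:E <=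
    (`|lambda_const| * (corr_const `^ (2 * p - 2) * M `^ p))%:E)%E.
Proof.
move=> Oz Bt hM; have mH := measurable_weighted_density Oz Bt.
have H0 w : 0 <= weighted_density z t w by rewrite !mulr_ge0 ?powR_ge0.
have comp_phi (f : B -> R) : measurable_fun OmB f ->
    measurable_fun OmB (fun w : B => f (phi z w)).
  move=> mf; apply: (measurable_comp mOm _ mf (measurable_phi Oz)).
  by move=> _ [w Ow <-]; exact: phi_Om.
apply: (le_trans (lambda_involution_le Oz mH (fun w _ => H0 w))).
rewrite EFinM; apply: lee_wpmul2l; first by rewrite lee_fin.
rewrite (@integral_lambda (fun w => weighted_density z t (phi z w)));
  last 2 first.
- exact: (comp_phi (weighted_density z t)).
- by move=> w _; exact: H0.
have mtr : measurable_fun OmB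
    (fun w : B => (cabs (transl sigma Om K phi z t w) `^ p)%:E).
  apply/measurable_EFinP; apply: measurable_powR_comp.
  under eq_fun do rewrite /transl cabsM; apply: measurable_funM.
    exact: (comp_phi (fun w => cabs (t w)) (Bspace_measurable_cabs openOm Bt)).
  exact: (Bspace_measurable_cabs openOm (Bspace_nkernel Oz)).
apply: (@le_trans _ _ (\int[sigma]_(w in OmB)
   ((corr_const `^ (2 * p - 2))%:E *
    (cabs (transl sigma Om K phi z t w) `^ p)%:E))%E).
  apply: ge0_le_integral => //.
  - by move=> w _; rewrite lee_fin mulr_ge0 ?sqr_ge0.
  - apply/measurable_EFinP/measurable_funM; first exact: comp_phi.
    by apply: measurable_funX; exact: measurable_Knorm.
  - exact: measurable_funeM.
  - by move=> w Ow; rewrite -EFinM lee_fin weighted_density_involution_le.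
rewrite ge0_integralZl_EFin ?powR_ge0//; last first.
  by move=> w _; rewrite lee_fin powR_ge0.
rewrite EFinM; apply: lee_wpmul2l; first by rewrite lee_fin powR_ge0.
rewrite integral_transl_powR// -poweR_EFin.
have M0 : (0 <= M%:E)%E by apply: le_trans hM; exact: Lnorm_ge0.
by apply: (gt0_ler_poweR (ltW p0)); rewrite // in_itv/= leey andbT// Lnorm_ge0.
Qed.

Variables (beta Mrf : R).
Let q := p / (p - 1).
Let a := 1 - beta / q.

Definition rudin_forelli r s M := forall z, Om z ->
  (\int[sigma]_(w in OmB)
    ((cabs (ip (K z) (K w)) `^ ((r + s) / 2) / (KN z `^ s * KN w `^ r))
       * KN w ^+ 2)%:E <= M%:E)%E.

Hypothesis rf : rudin_forelli (2 - q + beta) (2 - q - beta) Mrf.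

Lemma rudin_forelli_correlation z : Om z ->
  (\int[lambda_measure]_(w in OmB)
     (kcorr z w `^ (2 - q) * KN w `^ (- beta))%:E <=
   (KN z `^ (- beta) * `|Mrf|)%:E)%E.
Proof.
move=> Oz; have mcorr : measurable_fun OmB
    (fun w : B => kcorr z w `^ (2 - q) * KN w `^ (- beta)).
  apply: measurable_funM; apply: measurable_powR_comp;
    last exact: measurable_Knorm.
  exact: measurable_kernel_correlation.
have corr0 w : 0 <= kcorr z w `^ (2 - q) * KN w `^ (- beta).
  by rewrite mulr_ge0 ?powR_ge0.
have KNz_gt0 : 0 < KN z `^ beta by rewrite powR_gt0 ?KN_gt0.
rewrite powRN EFinM lee_pdivlMl//.
rewrite -ge0_integralZl_EFin ?(ltW KNz_gt0)//; last 2 first.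
- by move=> w _; rewrite lee_fin.
- exact/measurable_EFinP.
under eq_integral do rewrite -EFinM.
rewrite (@integral_lambda (fun w =>
  KN z `^ beta * (kcorr z w `^ (2 - q) * KN w `^ (- beta)))).
- apply: le_trans (_ : (Mrf%:E <= `|Mrf|%:E)%E);
    last by rewrite lee_fin ler_norm.
  apply: le_trans (rf Oz); rewrite le_eqVlt; apply/orP; left; apply/eqP.
  apply: eq_integral => w /set_mem Ow; congr (_ * _)%:E.
  rewrite -(reproducing (Bspace_kernel Oz) Ow) cabs_kernel//.
  by rewrite rudin_forelli_integrand ?KN_gt0 ?kcorr_gt0.
- exact: measurable_funM.
- by move=> w _; rewrite mulr_ge0 ?powR_ge0.
Qed.

Let q0 : 0 < q.
Proof. by rewrite divr_gt0 ?subr_gt0// (lt_trans _ p2)// ltr1n. Qed.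

Lemma hoelder_kernel_row z t : Om z -> Bs t ->
  (\int[sigma]_(w in OmB) (cabs (t w) * KN w `^ a)%:E <=
   (\int[lambda_measure]_(w in OmB) (weighted_density z t w)%:E) `^ p^-1 *
   (\int[lambda_measure]_(w in OmB)
     (kcorr z w `^ (2 - q) * KN w `^ (- beta))%:E) `^ q^-1)%E.
Proof.
move=> Oz Bt; have p1 : 1 < p by apply: lt_trans p2; rewrite ltr1n.
have pq : p^-1 + q^-1 = 1 by rewrite /q; field; rewrite !gt_eqF ?subr_gt0.
pose f w := cabs (t w) / KN w * kcorr z w `^ ((2 - p) / p).
pose g w := KN w `^ (a - 1) * kcorr z w `^ ((p - 2) / p).
have mKN := measurable_Knorm; have mcorr := measurable_kernel_correlation Oz.
have mf : measurable_fun OmB (f : B -> R).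
  apply: measurable_funM; last exact: measurable_powR_comp.
  apply: measurable_funM; first exact: (Bspace_measurable_cabs openOm Bt).
  exact: measurable_funV_gt0.
have mg : measurable_fun OmB (g : B -> R).
  by apply: measurable_funM; exact: measurable_powR_comp.
have f0 w : Om w -> 0 <= f w.
  move=> Ow.
  by rewrite mulr_ge0 ?divr_ge0 ?powR_ge0 ?cabs_ge0 ?(ltW (KN_gt0 Ow)).
have g0 w : Om w -> 0 <= g w by move=> _; rewrite mulr_ge0 ?powR_ge0.
have fgE : (\int[lambda_measure]_(w in OmB) (f w * g w)%:E =
    \int[sigma]_(w in OmB) (cabs (t w) * KN w `^ a)%:E)%E.
  rewrite (@integral_lambda (fun w => f w * g w)); last 2 first.
  - exact: measurable_funM.
  - by move=> w Ow; rewrite mulr_ge0 ?f0 ?g0.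
  apply: eq_integral => w /set_mem Ow.
  by rewrite /f /g hoelder_factors_mul ?KN_gt0 ?kcorr_gt0.
have fpE : (\int[lambda_measure]_(w in OmB) (f w `^ p)%:E =
    \int[lambda_measure]_(w in OmB) (weighted_density z t w)%:E)%E.
  apply: eq_integral => w /set_mem Ow.
  by rewrite /f hoelder_factor_powR ?cabs_ge0 ?KN_gt0 ?kcorr_gt0.
have gqE : (\int[lambda_measure]_(w in OmB) (g w `^ q)%:E =
    \int[lambda_measure]_(w in OmB)
      (kcorr z w `^ (2 - q) * KN w `^ (- beta))%:E)%E.
  apply: eq_integral => w /set_mem Ow.
  rewrite /g (_ : a - 1 = - beta / q); last by rewrite /a; ring.
  by rewrite (conjugate_factor_powR (p := p)) ?KN_gt0 ?kcorr_gt0.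
rewrite -fgE -fpE -gqE.
exact: (hoelder_on lambda_measure mOm mf mg f0 g0 p0 q0 pq).
Qed.

Definition row_const M :=
  (`|lambda_const| * (corr_const `^ (2 * p - 2) * M `^ p)) `^ p^-1 *
  `|Mrf| `^ q^-1.

Lemma row_const_ge0 M : 0 <= row_const M.
Proof. by rewrite mulr_ge0 ?powR_ge0. Qed.

Lemma kernel_row_estimate z t M : Om z -> Bs t ->
  (transl_norm z t <= M%:E)%E ->
  (\int[sigma]_(w in OmB) (cabs (t w) * KN w `^ a)%:E <=
    (row_const M * KN z `^ (a - 1))%:E)%E.
Proof.
move=> Oz Bt hM; apply: (le_trans (hoelder_kernel_row Oz Bt)).
set X := `|lambda_const| * (corr_const `^ (2 * p - 2) * M `^ p).
have -> : row_const M * KN z `^ (a - 1) =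
    X `^ p^-1 * (KN z `^ (- beta) * `|Mrf|) `^ q^-1.
  rewrite /row_const -/X powRM ?powR_ge0// -powRrM -mulrA; congr (_ * _).
  by rewrite mulrC; congr (_ `^ _ * _); rewrite /a; ring.
have X0 : 0 <= X by rewrite !mulr_ge0 ?powR_ge0.
have ler_root (r : R) (x y : \bar R) : 0 < r ->
    (0 <= x -> x <= y -> x `^ r^-1 <= y `^ r^-1)%E.
  move=> r0 x0 xy; apply: gt0_ler_poweR; rewrite ?invr_ge0 ?(ltW r0)//;
    rewrite in_itv/= leey andbT//.
  exact: le_trans xy.
rewrite EFinM -!poweR_EFin.
apply: lee_pmul; rewrite ?poweR_ge0//; apply: ler_root => //.
- by apply: integral_ge0 => w _; rewrite lee_fin !mulr_ge0 ?powR_ge0.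
- exact: translated_Lp_le.
- by apply: integral_ge0 => w _; rewrite lee_fin mulr_ge0 ?powR_ge0.
- exact: rudin_forelli_correlation.
Qed.

Lemma transl_row_bounded S M : kspan_operator S ->
  (forall z, Om z -> (transl_norm z (S (k_ z)) <= M%:E)%E) ->
  row_bounded a (row_const M) S.
Proof.
move=> [lS BS] hM z Oz; have BSk := BS _ (kspan_nkernel Oz).
have KNz_gt0 := KN_gt0 Oz.
have -> : S (K z) = Complex (KN z) 0 *: S (k_ z).
  rewrite {1}(kernel_nkernel Oz) (linear_onZ _ kspan_subspace lS)//.
  exact: kspan_nkernel.
rewrite (eq_integral (fun w : B =>
    (KN z)%:E * (cabs (S (k_ z) w) * KN w `^ a)%:E)%E); last first.
  move=> w _; rewrite -EFinM mulrA; congr (_ * _)%:E.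
  by rewrite cabsM cabs_real// ltW.
rewrite ge0_integralZl_EFin ?(ltW KNz_gt0)//; last 2 first.
- by move=> w _; rewrite lee_fin mulr_ge0 ?cabs_ge0 ?powR_ge0.
- apply/measurable_EFinP/measurable_funM.
    exact: (Bspace_measurable_cabs openOm BSk).
  exact: measurable_powR_comp measurable_Knorm.
have -> : KN z `^ a = KN z * KN z `^ (a - 1).
  rewrite -{2}[KN z](powRr1 (ltW KNz_gt0)) -powRD ?(gt_eqF KNz_gt0) ?implybT//.
  by rewrite addrC subrK.
rewrite mulrCA EFinM; apply: lee_wpmul2l; first by rewrite lee_fin ltW.
exact: kernel_row_estimate (hM z Oz).
Qed.

Theorem transl_bounded_extension T Tstar M Mstar : Bcomplete sigma Om ->
  kspan_operator T -> kspan_operator Tstar -> adjoint_on_kernels T Tstar ->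
  (forall z, Om z -> (transl_norm z (T (k_ z)) <= M%:E)%E) ->
  (forall z, Om z -> (transl_norm z (Tstar (k_ z)) <= Mstar%:E)%E) ->
  has_bounded_extension T.
Proof.
move=> complete_B opT opTstar adj transT transTstar.
have rowT := transl_row_bounded opT transT.
have rowTstar := transl_row_bounded opTstar transTstar.
exact: (bounded_extension complete_B opT opTstar adj (row_const_ge0 M)
  (row_const_ge0 Mstar) rowT rowTstar).
Qed.

End HoelderEstimate.
End Translation.
End ReproducingKernel.

(* If [kappa] is positive, [c + beta] and [c - beta] have to straddle it. *)
Lemma exists_rudin_forelli_shift (R : realType) (kappa c : R)
    (P : R -> R -> Prop) :
  0 <= kappa -> kappa / 2 < c ->
  (0 < kappa -> forall r s, kappa < r -> 0 < s -> s < kappa -> P r s) ->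
  (kappa = 0 -> forall r, 0 < r -> P r r) ->
  exists beta, P (c + beta) (c - beta).
Proof.
move=> kappa0 kappa_lt Ppos Pzero.
have [kappa_eq0|kappa_neq0] := eqVneq kappa 0.
  by exists 0; rewrite addr0 subr0; apply: Pzero => //; lra.
have kappa_gt0 : 0 < kappa by rewrite lt_def kappa_neq0.
pose m := Num.max (kappa - c) (c - kappa).
have m1 : kappa - c <= m by rewrite le_max lexx.
have m2 : c - kappa <= m by rewrite le_max lexx orbT.
have mc : m < c by rewrite gt_max; apply/andP; split; lra.
by exists ((m + c) / 2); apply: Ppos => //; lra.
Qed.

Lemma bergman_exponent_bounds (R : realType) (kappa p : R) :
  0 <= kappa -> kappa < 2 -> (4 - kappa) / (2 - kappa) < p ->
  2 < p /\ kappa / 2 < 2 - p / (p - 1).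
Proof.
move=> kappa0 kappa2; rewrite ltr_pdivrMr ?subr_gt0// => hp.
have p2 : 2 < p by nra.
have p1 : 0 < p - 1 by lra.
split=> //; rewrite (_ : 2 - _ = (p - 2) / (p - 1)); last first.
  by field; rewrite gt_eqF.
by rewrite ltr_pdivlMr//; nra.
Qed.

Theorem theorem3p1 (R : realType) (n : nat) (Om : set (Cn R n))
  (phi : Cn R n -> Cn R n -> Cn R n) (d : Cn R n -> Cn R n -> R)
  (sigma : {measure set CBorel R n -> \bar R}) (K : Cn R n -> Cn R n -> R[i])
  (kappa : R)
  (T Tstar : (Cn R n -> R[i]) -> (Cn R n -> R[i])) (p : R) :
  bergman_type Om phi d sigma K kappa ->
  (* T and T^* are linear operators on span{k_z} with values in B(Om) *)
  (forall f g (a : R[i]), kspan sigma Om K f -> kspan sigma Om K g ->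
     T (fun w => a * f w + g w) = (fun w => a * T f w + T g w)) ->
  (forall f g (a : R[i]), kspan sigma Om K f -> kspan sigma Om K g ->
     Tstar (fun w => a * f w + g w) = (fun w => a * Tstar f w + Tstar g w)) ->
  (forall f, kspan sigma Om K f -> Bspace sigma Om (T f)) ->
  (forall f, kspan sigma Om K f -> Bspace sigma Om (Tstar f)) ->
  (* <T k_z, k_w> = <k_z, T^* k_w> *)
  (forall z w, Om z -> Om w ->
     inner sigma Om (T (nkernel sigma Om K z)) (nkernel sigma Om K w) =
     inner sigma Om (nkernel sigma Om K z) (Tstar (nkernel sigma Om K w))) ->
  (4 - kappa) / (2 - kappa) < p ->
  (exists M : R, forall z, Om z ->
     (Lnorm sigma p%:E (fun w => (cabs (transl sigma Om K phi z
        (T (nkernel sigma Om K z)) w))%:E) <= M%:E)%E) ->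
  (exists M : R, forall z, Om z ->
     (Lnorm sigma p%:E (fun w => (cabs (transl sigma Om K phi z
        (Tstar (nkernel sigma Om K z)) w))%:E) <= M%:E)%E) ->
  (* T extends to a bounded operator on B(Om) *)
  exists S : (Cn R n -> R[i]) -> (Cn R n -> R[i]),
    (forall f, Bspace sigma Om f -> Bspace sigma Om (S f)) /\
    (forall f g (a : R[i]), Bspace sigma Om f -> Bspace sigma Om g ->
       S (fun w => a * f w + g w) = (fun w => a * S f w + S g w)) /\
    (exists c : R, forall f, Bspace sigma Om f ->
       L2norm sigma Om (S f) <= c * L2norm sigma Om f) /\
    (forall f, kspan sigma Om K f -> S f = T f).
Proof.
move=> [[openOm _] [_ [phiA [_ [_ [_ [_ [_ [sigma_fin [repK [complete_B [_
  [[lambda_const quasi] [_ [[corr_const corr] [kappa0 [kappa2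
  [[rf_pos rf_zero] _]]]]]]]]]]]]]]]]]].
move=> linT linTstar BT BTstar adj p_lt [M transT] [Mstar transTstar].
have [p2 kappa_lt] := bergman_exponent_bounds kappa0 kappa2 p_lt.
have [beta [Mrf rf]] :=
  exists_rudin_forelli_shift kappa0 kappa_lt rf_pos rf_zero.
have [S [BS [linS bounded_extending]]] :
    has_bounded_extension sigma Om K T.
  apply: (transl_bounded_extension openOm sigma_fin repK (phi := phi)
    (lambda_const := lambda_const) (corr_const := corr_const) _ _ _ _ _ p2 rf
    complete_B _ _ adj transT transTstar).
  - by move=> z w /phiA[+ _]; exact.
  - by move=> z w /phiA[_ [+ _]]; exact.
  - by move=> z /phiA[_ [_ []]].
  - by move=> z E Oz mE EO; have [] := quasi z E Oz mE EO.
  - by move=> z w Oz Ow; have [] := corr z w Oz Ow.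
  - by split=> // b f g; exact: linT.
  - by split=> // b f g; exact: linTstar.
by exists S; split=> //; split=> // f g b; exact: linS.
Qed.
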